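(* There is a fixed finitely generated submonoid of the free metabelian group of rank $2$ whose membership problem is undecidable.
   Context: The free metabelian group of rank $2$ is $F/[[F,F],[F,F]]$ where $F$ is the free group on two generators $x,y$. The membership problem for a submonoid $S$ asks, given a word over $\{x,y,x^{-1},y^{-1}\}$, whether the element it represents lies in $S$. *)

(* Defs.v *)
From Stdlib Require Import List Arith Relations.
Import ListNotations.

Inductive letter : Type := X | Y | Xi | Yi.

Definition linv (a : letter) : letter :=
  match a with X => Xi | Y => Yi | Xi => X | Yi => Y end.

Definition word := list letter.

Definition winv (w : word) : word := rev (map linv w).

Inductive cancel1 : word -> word -> Prop :=
| cancel1_intro (u v : word) (a : letter) :
    cancel1 (u ++ a :: linv a :: v) (u ++ v).

Definition freq : word -> word -> Prop := clos_refl_sym_trans word cancel1.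

Inductive gen (P : word -> Prop) : word -> Prop :=
| gen_base w : P w -> gen P w
| gen_nil : gen P []
| gen_app u v : gen P u -> gen P v -> gen P (u ++ v)
| gen_inv u : gen P u -> gen P (winv u)
| gen_eq u v : freq u v -> gen P u -> gen P v.

Definition comm (u v : word) : word := winv u ++ winv v ++ u ++ v.

Definition D1 : word -> Prop := gen (fun w => exists u v, w = comm u v).

Definition D2 : word -> Prop :=
  gen (fun w => exists u v, D1 u /\ D1 v /\ w = comm u v).

(** equality in the free metabelian group M = F / [[F,F],[F,F]] *)
Definition meq (w w' : word) : Prop := D2 (w ++ winv w').

Definition in_submonoid (gens : list word) (w : word) : Prop :=
  exists prod : list word, Forall (fun g => In g gens) prod /\ meq (concat prod) w.

Inductive instr : Type :=
| INC (r : nat)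
| DECJZ (r : nat) (j : nat).

Definition program := list instr.
Definition regs := nat -> nat.

Definition upd (f : regs) (r v : nat) : regs :=
  fun r' => if Nat.eqb r' r then v else f r'.

Fixpoint run (p : program) (fuel pc : nat) (f : regs) : option regs :=
  match nth_error p pc with
  | None => Some f
  | Some i =>
      match fuel with
      | 0 => None
      | S fuel' =>
          match i with
          | INC r => run p fuel' (S pc) (upd f r (S (f r)))
          | DECJZ r j =>
              match f r with
              | 0 => run p fuel' j f
              | S k => run p fuel' (S pc) (upd f r k)
              end
          end
      end
  end.

(** standard injective encoding of words as natural numbers (bijective base 5) *)
Definition lcode (a : letter) : nat :=
  match a with X => 1 | Y => 2 | Xi => 3 | Yi => 4 end.
Fixpoint wcode (w : word) : nat :=
  match w with [] => 0 | a :: w' => lcode a + 5 * wcode w' end.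

Definition init (n : nat) : regs := fun r => if Nat.eqb r 0 then n else 0.

Definition cm_decidable (P : word -> Prop) : Prop :=
  exists p : program, forall w : word,
    exists fuel f, run p fuel 0 (init (wcode w)) = Some f /\
      ((P w /\ f 1 = 1) \/ (~ P w /\ f 1 = 0)).

(* Main.v *)
Require Import Defs.
From Stdlib Require Import List Arith Lia ZArith Relations Permutation Setoid Morphisms Classical ClassicalEpsilon FunctionalExtensionality.
Import ListNotations.

(* The commutator subgroup modulo D2 is seen through flows of paths on the grid Z^2: any weight
   on vertical edges gives a functional on words which vanishes on D2. In the submonoid generated
   by X^m, X^-m, Y, Y^-1 and by elements of D1, those elements may be translated along
   the sublattice mZ x Z and combined with nonnegative coefficients, and the vertical edges in
   between are m - 1 colors of formal tokens. A rule replacing some tokens by others thus becomes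
   a generator. A fixed FRACTRAN program is turned into such rules, where a single
   token carries the configuration and static marks along two lines certify divisibility. Rules
   have no order, so soundness is proved by duality: if the program does not halt, a suitable
   weight is monotone along all rules but positive on the target.
   The FRACTRAN program is an interpreter of FRACTRAN programs, obtained from a counter
   machine. A decider for membership would yield a counter machine that, run on the code n of its
   own FRACTRAN translation, halts iff the word encoding this very run is not a member. *)

(** * Words modulo the derived subgroups *)

(** In a product of generators only the sum of the translated rules is visible. A derivation may
    therefore spend a token before it exists, and each rule acts at every translate, so no rule can
    refer to the origin by itself. A zero test must get the origin from the target word: this is why
    the target contains two sources of marks placed there. A source that emitted marks without
    moving would cancel from its own rule and make marks free everywhere, so it steps away at each
    emission. Off its line, a weight that respects both emission and deletion of a source cannot
    exist on the whole plane, since it would grow without bound along the path of the source and yet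
    stay nonpositive. A given product, however, explores a bounded region only, and the weight may
    depend on that bound. FRACTRAN fits because a configuration is one number, hence one coordinate
    of one token, and multiplication by n/d is a straight walk from one axis to the other. The
    interpreter is needed because the submonoid is fixed before the decider is known, while the
    program that defeats the decider depends on it and can only enter through the input. *)

Lemma linv_linv a : linv (linv a) = a.
Proof. now destruct a. Qed.

Lemma winv_app u v : winv (u ++ v) = winv v ++ winv u.
Proof. unfold winv. now rewrite map_app, rev_app_distr. Qed.

Lemma winv_winv u : winv (winv u) = u.
Proof.
  unfold winv. rewrite map_rev, rev_involutive, map_map.
  rewrite <- (map_id u) at 2. apply map_ext, linv_linv.
Qed.

Global Instance freq_equivalence : Equivalence freq.
Proof.
  unfold freq; split; red; intros.
  - apply rst_refl.
  - now apply rst_sym.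
  - eapply rst_trans; eauto.
Qed.

Lemma freq_map (h : word -> word) :
  (forall u v, cancel1 u v -> cancel1 (h u) (h v)) ->
  forall u v, freq u v -> freq (h u) (h v).
Proof.
  intros H u v; induction 1; [apply rst_step; auto|apply rst_refl|now apply rst_sym|].
  eapply rst_trans; eauto.
Qed.

Global Instance freq_app : Proper (freq ==> freq ==> freq) (@app letter).
Proof.
  intros u u' Hu v v' Hv. transitivity (u' ++ v).
  - revert u u' Hu. apply freq_map. intros _ _ [u w a].
    rewrite <- !app_assoc. simpl. constructor.
  - revert v v' Hv. apply freq_map. intros _ _ [v w a].
    rewrite !app_assoc. constructor.
Qed.

Global Instance freq_winv : Proper (freq ==> freq) winv.
Proof.
  intros u v. apply freq_map. intros _ _ [p q a].
  rewrite !winv_app. unfold winv at 1. simpl. rewrite linv_linv, <- !app_assoc. simpl. constructor.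
Qed.

Lemma freq_winv_r w : freq (w ++ winv w) [].
Proof.
  induction w as [|a w IH]; [reflexivity|].
  change (a :: w) with ([a] ++ w). rewrite winv_app, <- app_assoc, (app_assoc w), IH.
  apply rst_step, (cancel1_intro [] [] a).
Qed.

Lemma freq_winv_l w : freq (winv w ++ w) [].
Proof. rewrite <- (winv_winv w) at 2. apply freq_winv_r. Qed.

Lemma freq_cancel_r w v : freq (w ++ winv w ++ v) v.
Proof. rewrite app_assoc, freq_winv_r. reflexivity. Qed.

Lemma freq_cancel_l w v : freq (winv w ++ w ++ v) v.
Proof. rewrite app_assoc, freq_winv_l. reflexivity. Qed.

Definition conj (w u : word) : word := w ++ u ++ winv w.

Ltac grp :=
  unfold conj, comm;
  rewrite ?winv_app, ?winv_winv, <- ?app_assoc;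
  repeat first
    [ rewrite freq_cancel_r | rewrite freq_cancel_l
    | rewrite freq_winv_r | rewrite freq_winv_l | rewrite app_nil_r ];
  try reflexivity.

Record normal (N : word -> Prop) : Prop := {
  normal_nil : N [];
  normal_app u v : N u -> N v -> N (u ++ v);
  normal_inv u : N u -> N (winv u);
  normal_freq u v : freq u v -> N u -> N v;
  normal_conj w u : N u -> N (conj w u) }.

Lemma gen_normal P :
  (forall w u, P u -> gen P (conj w u)) -> normal (gen P).
Proof.
  intros H; split; [apply gen_nil|apply gen_app|apply gen_inv|apply gen_eq|].
  intros w u; induction 1.
  - auto.
  - apply gen_eq with []; [grp|apply gen_nil].
  - apply gen_eq with (conj w u ++ conj w v); [grp|now apply gen_app].
  - apply gen_eq with (winv (conj w u)); [grp|now apply gen_inv].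
  - apply gen_eq with (conj w u); [|assumption].
    unfold conj. now rewrite H0.
Qed.

Lemma conj_comm w u v : freq (comm (conj w u) (conj w v)) (conj w (comm u v)).
Proof. grp. Qed.

Lemma D1_normal : normal D1.
Proof.
  apply gen_normal. intros w _ (u & v & ->).
  eapply gen_eq; [apply conj_comm|]. apply gen_base; eauto.
Qed.

Lemma D2_normal : normal D2.
Proof.
  apply gen_normal. intros w _ (u & v & Hu & Hv & ->).
  eapply gen_eq; [apply conj_comm|]. apply gen_base.
  exists (conj w u), (conj w v).
  split; [|split]; try reflexivity; now apply (normal_conj _ D1_normal).
Qed.

(** Used at [D1], where it is equality in the abelianization, and at [D2], where it is convertible
    to [meq]; both support setoid rewriting. *)
Definition eqmod (N : word -> Prop) (u v : word) : Prop := N (u ++ winv v).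

Lemma freq_eqmod N u v : normal N -> freq u v -> eqmod N u v.
Proof.
  intros HN H. apply (normal_freq _ HN) with []; [|apply (normal_nil _ HN)].
  rewrite H. symmetry. grp.
Qed.

Lemma eqmod_equivalence N : normal N -> Equivalence (eqmod N).
Proof.
  intros HN; split; red.
  - intros u. now apply freq_eqmod.
  - intros u v H. apply (normal_inv _ HN) in H.
    revert H. apply (normal_freq _ HN). grp.
  - intros u v w H K. generalize (normal_app _ HN _ _ H K).
    apply (normal_freq _ HN). grp.
Qed.

Lemma eqmod_app N : normal N -> Proper (eqmod N ==> eqmod N ==> eqmod N) (@app letter).
Proof.
  intros HN u u' H v v' K.
  generalize (normal_app _ HN _ _ (normal_conj _ HN u _ K) H).
  apply (normal_freq _ HN). grp.
Qed.

Lemma eqmod_winv N : normal N -> Proper (eqmod N ==> eqmod N) winv.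
Proof.
  intros HN u v H. generalize (normal_conj _ HN (winv v) _ (normal_inv _ HN _ H)).
  apply (normal_freq _ HN). grp.
Qed.

Global Instance ab_equivalence : Equivalence (eqmod D1) := eqmod_equivalence _ D1_normal.
Global Instance ab_app : Proper (eqmod D1 ==> eqmod D1 ==> eqmod D1) (@app letter) :=
  eqmod_app _ D1_normal.
Global Instance meq_equivalence : Equivalence meq := eqmod_equivalence _ D2_normal.
Global Instance meq_app : Proper (meq ==> meq ==> meq) (@app letter) := eqmod_app _ D2_normal.
Global Instance meq_winv : Proper (meq ==> meq) winv := eqmod_winv _ D2_normal.

Global Instance freq_sub_ab : subrelation freq (eqmod D1).
Proof. intros u v. apply freq_eqmod, D1_normal. Qed.

Global Instance freq_sub_meq : subrelation freq meq.
Proof. intros u v. apply (freq_eqmod D2), D2_normal. Qed.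

Lemma ab_swap u v : eqmod D1 (u ++ v) (v ++ u).
Proof.
  apply gen_eq with (comm (winv u) (winv v)); [grp|].
  apply gen_base. eauto.
Qed.

Lemma D1_swap u v : D1 u -> D1 v -> meq (u ++ v) (v ++ u).
Proof.
  intros Hu Hv. apply gen_eq with (comm (winv u) (winv v)); [grp|].
  apply gen_base. exists (winv u), (winv v).
  split; [|split]; try reflexivity; now apply (normal_inv _ D1_normal).
Qed.

(** The two conjugators differ by an element of [D1], which commutes with the conjugate of [d]
    modulo [D2]. Hence Z^2 acts on the commutator subgroup, and conjugation becomes translation. *)
Lemma conj_ab u v d : eqmod D1 u v -> D1 d -> meq (conj u d) (conj v d).
Proof.
  intros H Hd.
  transitivity ((u ++ winv v) ++ conj v d ++ winv (u ++ winv v)).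
  { apply freq_sub_meq. symmetry. grp. }
  rewrite app_assoc, (D1_swap _ (conj v d) H) by now apply (normal_conj _ D1_normal).
  apply freq_sub_meq. grp.
Qed.

(** * Flow functionals vanishing on the second derived subgroup *)

Local Open Scope Z_scope.
Local Arguments Z.add : simpl never.
Local Arguments Z.sub : simpl never.
Local Arguments Z.mul : simpl never.
Local Arguments Z.opp : simpl never.

Fixpoint dx (w : word) : Z :=
  match w with
  | [] => 0
  | X :: w => 1 + dx w
  | Xi :: w => -1 + dx w
  | _ :: w => dx w
  end.

Fixpoint dy (w : word) : Z :=
  match w with
  | [] => 0
  | Y :: w => 1 + dy w
  | Yi :: w => -1 + dy w
  | _ :: w => dy w
  end.

(* [val psi i j w]: signed sum of the weights [psi] over the vertical edges
   (i,j) -> (i,j+1) of the grid Z^2 crossed by the path spelled by [w] from (i,j). *)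
Fixpoint val (psi : Z -> Z -> Z) (i j : Z) (w : word) : Z :=
  match w with
  | [] => 0
  | X :: w => val psi (i + 1) j w
  | Xi :: w => val psi (i - 1) j w
  | Y :: w => psi i j + val psi i (j + 1) w
  | Yi :: w => - psi i (j - 1) + val psi i (j - 1) w
  end.

Lemma dx_app u v : dx (u ++ v) = dx u + dx v.
Proof. induction u as [|[] u IH]; simpl; lia. Qed.

Lemma dy_app u v : dy (u ++ v) = dy u + dy v.
Proof. induction u as [|[] u IH]; simpl; lia. Qed.

Lemma val_app psi u v : forall i j,
  val psi i j (u ++ v) = val psi i j u + val psi (i + dx u) (j + dy u) v.
Proof.
  induction u as [|a u IH]; intros i j; [now rewrite !Z.add_0_r|].
  destruct a; simpl; rewrite IH.
  - now replace (i + (1 + dx u)) with (i + 1 + dx u) by lia.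
  - replace (j + (1 + dy u)) with (j + 1 + dy u) by lia. lia.
  - now replace (i + (-1 + dx u)) with (i - 1 + dx u) by lia.
  - replace (j + (-1 + dy u)) with (j - 1 + dy u) by lia. lia.
Qed.

Lemma dx_winv u : dx (winv u) = - dx u.
Proof.
  induction u as [|a u IH]; [reflexivity|].
  change (a :: u) with ([a] ++ u). rewrite winv_app, !dx_app, IH. destruct a; simpl; lia.
Qed.

Lemma dy_winv u : dy (winv u) = - dy u.
Proof.
  induction u as [|a u IH]; [reflexivity|].
  change (a :: u) with ([a] ++ u). rewrite winv_app, !dy_app, IH. destruct a; simpl; lia.
Qed.

Lemma freq_invariant (T : Type) (h : word -> T) :
  (forall u v a, h (u ++ a :: linv a :: v) = h (u ++ v)) ->
  forall u v, freq u v -> h u = h v.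
Proof.
  intros H u v; induction 1; try congruence. destruct H0. apply H.
Qed.

Lemma dx_freq u v : freq u v -> dx u = dx v.
Proof.
  apply freq_invariant. intros p q a.
  rewrite !dx_app. destruct a; simpl; lia.
Qed.

Lemma dy_freq u v : freq u v -> dy u = dy v.
Proof.
  apply freq_invariant. intros p q a.
  rewrite !dy_app. destruct a; simpl; lia.
Qed.

Lemma val_freq psi i j u v : freq u v -> val psi i j u = val psi i j v.
Proof.
  apply (freq_invariant _ (val psi i j)). intros p q a.
  rewrite !val_app. f_equal. destruct a; simpl;
    rewrite ?Z.add_simpl_r, ?Z.sub_add; lia.
Qed.

Lemma val_winv psi i j u : val psi i j (winv u) = - val psi (i - dx u) (j - dy u) u.
Proof.
  assert (H := val_freq psi (i - dx u) (j - dy u) _ _ (freq_winv_r u)).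
  rewrite val_app in H. simpl in H.
  replace (i - dx u + dx u) with i in H by lia.
  replace (j - dy u + dy u) with j in H by lia. lia.
Qed.

Lemma D1_closed w : D1 w -> dx w = 0 /\ dy w = 0.
Proof.
  induction 1 as [w (u & v & ->)| |u v _ IHu _ IHv|u _ IH|u v H _ IH].
  - unfold comm. rewrite !dx_app, !dy_app, !dx_winv, !dy_winv. lia.
  - now split.
  - rewrite dx_app, dy_app. lia.
  - rewrite dx_winv, dy_winv. lia.
  - rewrite <- (dx_freq _ _ H), <- (dy_freq _ _ H). assumption.
Qed.

Lemma D2_D1 w : D2 w -> D1 w.
Proof.
  induction 1 as [w (u & v & _ & _ & ->)| |u v _ IHu _ IHv|u _ IH|u v H _ IH].
  - apply gen_base; eauto.
  - apply gen_nil.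
  - now apply gen_app.
  - now apply gen_inv.
  - eapply gen_eq; eassumption.
Qed.

Lemma val_app_closed psi i j u v : D1 u ->
  val psi i j (u ++ v) = val psi i j u + val psi i j v.
Proof. intros [H K]%D1_closed. now rewrite val_app, H, K, !Z.add_0_r. Qed.

Lemma val_winv_closed psi i j u : D1 u -> val psi i j (winv u) = - val psi i j u.
Proof. intros [H K]%D1_closed. now rewrite val_winv, H, K, !Z.sub_0_r. Qed.

(** On closed paths from a common base point the functional is a homomorphism to the abelian group
    Z, so it kills commutators of elements of [D1]. *)
Lemma D2_val psi i j w : D2 w -> val psi i j w = 0.
Proof.
  induction 1 as [w (u & v & Hu & Hv & ->)| |u v Hu IHu Hv IHv|u Hu IH|u v H _ IH].
  - unfold comm.
    rewrite !val_app_closed, !val_winv_closed by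
      (try assumption; now apply (normal_inv _ D1_normal)). lia.
  - reflexivity.
  - rewrite val_app_closed by now apply D2_D1. lia.
  - rewrite val_winv_closed by now apply D2_D1. lia.
  - now rewrite <- (val_freq _ _ _ _ _ H).
Qed.

Lemma meq_val psi i j u v : meq u v -> val psi i j u = val psi i j v.
Proof.
  intros H. assert (K := D2_val psi i j _ H). apply D2_D1, D1_closed in H.
  rewrite dx_app, dx_winv, dy_app, dy_winv in H.
  rewrite val_app, val_winv in K.
  replace (i + dx u - dx v) with i in K by lia.
  replace (j + dy u - dy v) with j in K by lia. lia.
Qed.

Lemma dx_bound w : - Z.of_nat (length w) <= dx w.
Proof. induction w as [|[] w IH]; simpl; lia. Qed.

Lemma dy_bound w : - Z.of_nat (length w) <= dy w.
Proof. induction w as [|[] w IH]; simpl; lia. Qed.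

(** * Token systems in submonoids *)

Definition pow (a : letter) (z : Z) : word :=
  repeat (if z <? 0 then linv a else a) (Z.abs_nat z).

Lemma pow_nat a n : pow a (Z.of_nat n) = repeat a n.
Proof.
  unfold pow. destruct (Z.ltb_spec (Z.of_nat n) 0); [lia|]. f_equal. lia.
Qed.

Lemma pow_opp a z : pow a (- z) = winv (pow a z).
Proof.
  unfold pow, winv. rewrite map_repeat, rev_repeat.
  replace (Z.abs_nat (- z)) with (Z.abs_nat z) by lia.
  destruct (Z.ltb_spec z 0), (Z.ltb_spec (- z) 0);
    rewrite ?linv_linv; try reflexivity; try lia.
  now replace (Z.abs_nat z) with 0%nat by lia.
Qed.

Lemma pow_succ a z : freq (pow a (z + 1)) (pow a z ++ [a]).
Proof.
  destruct (Z_lt_le_dec z 0).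
  - replace z with (- Z.of_nat (S (Z.to_nat (- z - 1)))) by lia.
    generalize (Z.to_nat (- z - 1)). intros n.
    replace (- Z.of_nat (S n) + 1) with (- Z.of_nat n) by lia.
    rewrite !pow_opp, !pow_nat. simpl repeat.
    change (a :: repeat a n) with ([a] ++ repeat a n). grp.
  - rewrite <- (Z2Nat.id z) by assumption.
    replace (Z.of_nat (Z.to_nat z) + 1) with (Z.of_nat (S (Z.to_nat z))) by lia.
    rewrite !pow_nat. simpl. now rewrite repeat_cons.
Qed.

Lemma pow_add a x y : freq (pow a (x + y)) (pow a x ++ pow a y).
Proof.
  assert (H : forall n x, freq (pow a (x + Z.of_nat n)) (pow a x ++ pow a (Z.of_nat n))).
  { clear. induction n as [|n IH]; intros x.
    - rewrite Z.add_0_r. now rewrite app_nil_r.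
    - replace (x + Z.of_nat (S n)) with (x + Z.of_nat n + 1) by lia.
      replace (Z.of_nat (S n)) with (Z.of_nat n + 1) by lia.
      now rewrite !pow_succ, IH, app_assoc. }
  destruct (Z_lt_le_dec y 0).
  - replace y with (- Z.of_nat (Z.to_nat (- y))) by lia.
    generalize (Z.to_nat (- y)). intros n.
    specialize (H n (x + - Z.of_nat n)).
    replace (x + - Z.of_nat n + Z.of_nat n) with x in H by lia.
    rewrite H, pow_opp. grp.
  - rewrite <- (Z2Nat.id y) by assumption. apply H.
Qed.

Lemma dx_powX z : dx (pow X z) = z.
Proof.
  unfold pow. assert (H : forall n, dx (repeat X n) = Z.of_nat n /\ dx (repeat Xi n) = - Z.of_nat n).
  { induction n; cbn [repeat dx]; lia. }
  specialize (H (Z.abs_nat z)). destruct (Z.ltb_spec z 0); simpl; lia.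
Qed.

Lemma dy_powX z : dy (pow X z) = 0.
Proof. unfold pow. destruct (z <? 0); induction (Z.abs_nat z); simpl in *; auto. Qed.

Lemma dx_powY z : dx (pow Y z) = 0.
Proof. unfold pow. destruct (z <? 0); induction (Z.abs_nat z); simpl in *; auto. Qed.

Lemma dy_powY z : dy (pow Y z) = z.
Proof.
  unfold pow. assert (H : forall n, dy (repeat Y n) = Z.of_nat n /\ dy (repeat Yi n) = - Z.of_nat n).
  { induction n; cbn [repeat dy]; lia. }
  specialize (H (Z.abs_nat z)). destruct (Z.ltb_spec z 0); simpl; lia.
Qed.

Lemma val_powX psi z i j : val psi i j (pow X z) = 0.
Proof.
  unfold pow. revert i j.
  destruct (z <? 0); induction (Z.abs_nat z); intros i j; simpl in *; auto.
Qed.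

Lemma val_conj psi i j w u : D1 u ->
  val psi i j (conj w u) = val psi (i + dx w) (j + dy w) u.
Proof.
  intros [Hx Hy]%D1_closed. unfold conj. rewrite !val_app, val_winv, Hx, Hy.
  rewrite !Z.add_0_r, !Z.add_simpl_r. lia.
Qed.

(** Freely the word X^c Y X^-c Y^-1, the boundary of a rectangle of width c and height 1. Its
    vertical edges lie in column c (upward) and in column 0 (downward). *)
Definition kap (c : nat) : word := comm (pow X (- Z.of_nat c)) [Yi].

Lemma kap_D1 c : D1 (kap c).
Proof. apply gen_base. eexists _, _. reflexivity. Qed.

Lemma val_kap psi c i j : val psi i j (kap c) = psi (i + Z.of_nat c) j - psi i j.
Proof.
  unfold kap, comm. rewrite <- pow_opp, Z.opp_involutive.
  rewrite !val_app, !val_powX, !dx_powX, !dy_powX. simpl.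
  replace (i + Z.of_nat c + 0 + - Z.of_nat c) with i by lia.
  replace (j + 0) with j by lia. replace (j + (1 + 0) + 0 - 1) with j by lia.
  lia.
Qed.

Definition token : Type := nat * (Z * Z).

(* A token consists of a color and a position in Z^2. The colors 1, ..., m - 1 stand for the
   vertical edges strictly between two consecutive columns of the sublattice mZ x Z; the word
   of a token flows, off the sublattice columns, through the edge of its color only. *)
Definition tokw (m : nat) (t : token) : word :=
  let '(c, (a, b)) := t in conj (pow X (Z.of_nat m * a) ++ pow Y b) (kap c).

Definition toks (m : nat) (S : list token) : word := flat_map (tokw m) S.

Lemma toks_app m S T : toks m (S ++ T) = toks m S ++ toks m T.
Proof. apply flat_map_app. Qed.

Lemma tokw_D1 m t : D1 (tokw m t).
Proof. destruct t as (c & a & b). apply (normal_conj _ D1_normal), kap_D1. Qed.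

Lemma toks_D1 m S : D1 (toks m S).
Proof.
  induction S as [|t S IH]; [apply gen_nil|apply gen_app; [apply tokw_D1|exact IH]].
Qed.

(** Zero on the lattice columns, so that the generators X^m, X^-m, Y, Y^-1 read from a lattice point
    have value 0; on the other columns the residue is the color. *)
Definition weights (m : nat) (phi : nat -> Z -> Z -> Z) (i j : Z) : Z :=
  let r := i mod Z.of_nat m in
  if r =? 0 then 0 else phi (Z.to_nat r) (i / Z.of_nat m) j.

Lemma weights_lattice m phi a b : weights m phi (Z.of_nat m * a) b = 0.
Proof. unfold weights. now rewrite Z.mul_comm, Z_mod_mult. Qed.

Lemma weights_color m phi c a b : (0 < c < m)%nat ->
  weights m phi (Z.of_nat m * a + Z.of_nat c) b = phi c a b.
Proof.
  intros H. unfold weights.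
  rewrite (Z.mul_comm _ a), Z.add_comm, Z_mod_plus_full, Z.div_add by lia.
  rewrite Z.mod_small, Z.div_small by lia.
  destruct (Z.eqb_spec (Z.of_nat c) 0); [lia|]. now rewrite Nat2Z.id.
Qed.

Definition colored (m : nat) (S : list token) : Prop :=
  Forall (fun t => 0 < fst t < m)%nat S.

Fixpoint total (phi : nat -> Z -> Z -> Z) (a b : Z) (S : list token) : Z :=
  match S with
  | [] => 0
  | (c, (a', b')) :: T => phi c (a + a') (b + b') + total phi a b T
  end.

Lemma val_toks m phi S a b : colored m S ->
  val (weights m phi) (Z.of_nat m * a) b (toks m S) = total phi a b S.
Proof.
  induction 1 as [|(c & a' & b') S Hc HS IH]; [reflexivity|].
  change (toks m ((c, (a', b')) :: S)) with (tokw m (c, (a', b')) ++ toks m S).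
  rewrite val_app_closed by apply tokw_D1. rewrite IH. unfold tokw.
  rewrite val_conj by apply kap_D1.
  rewrite dx_app, dy_app, dx_powX, dy_powX, dx_powY, dy_powY, val_kap.
  rewrite !Z.add_0_r, Z.add_0_l, <- Z.mul_add_distr_l.
  rewrite weights_lattice, weights_color by assumption. simpl. lia.
Qed.

Definition rule : Type := list token * list token.

(** Additively left minus right: multiplying the right side by it yields the left side. Membership
    thus passes from right to left, and a configuration that can be rewritten to the empty one is a
    member. *)
Definition rulew (m : nat) (r : rule) : word := toks m (fst r) ++ winv (toks m (snd r)).

Definition gens_of (m : nat) (rules : list rule) : list word :=
  [pow X (Z.of_nat m); pow X (- Z.of_nat m); [Y]; [Yi]] ++ map (rulew m) rules.

Lemma rulew_D1 m r : D1 (rulew m r).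
Proof.
  apply gen_app; [|apply gen_inv]; apply toks_D1.
Qed.

Lemma gens_lattice m rules g : In g (gens_of m rules) -> exists a, dx g = Z.of_nat m * a.
Proof.
  intros [<-|[<-|[<-|[<-|(r & <- & _)%in_map_iff]]]].
  - exists 1. rewrite dx_powX. lia.
  - exists (-1). rewrite dx_powX. lia.
  - exists 0. simpl. lia.
  - exists 0. simpl. lia.
  - exists 0. destruct (D1_closed _ (rulew_D1 m r)). lia.
Qed.

Lemma dx_concat_lattice m rules l : Forall (fun g => In g (gens_of m rules)) l ->
  exists a, dx (concat l) = Z.of_nat m * a.
Proof.
  induction 1 as [|g l Hg _ (a & IH)]; [exists 0; simpl; lia|].
  destruct (gens_lattice _ _ _ Hg) as (a' & Ha). exists (a' + a).
  simpl. rewrite dx_app. lia.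
Qed.

(* The bound [B] may depend on the product witnessing membership: functionals that are
   monotone only above every -B still obstruct membership. *)
Lemma member_total m rules S :
  (0 < m)%nat ->
  (forall l r, In (l, r) rules -> colored m l /\ colored m r) -> colored m S ->
  in_submonoid (gens_of m rules) (toks m S) ->
  exists B, forall phi,
    (forall l r a b, In (l, r) rules -> - B <= a -> - B <= b ->
       total phi a b l <= total phi a b r) ->
    total phi 0 0 S <= 0.
Proof.
  intros Hm Hc HS (prod & Hprod & Heq).
  exists (Z.of_nat (length (concat prod))). intros phi Hphi.
  rewrite <- (val_toks m phi S 0 0 HS), Z.mul_0_r.
  rewrite <- (meq_val (weights m phi) 0 0 _ _ Heq).
  (* The prefix [l1] ends at a lattice point with coordinates bounded below by its length, so each
     further generator contributes at most 0. *)
  assert (H : forall l1 l2, prod = l1 ++ l2 ->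
    val (weights m phi) (dx (concat l1)) (dy (concat l1)) (concat l2) <= 0).
  2: { apply (H [] prod eq_refl). }
  intros l1 l2. revert l1.
  induction l2 as [|g l2 IH]; intros l1 E; [simpl; lia|].
  specialize (IH (l1 ++ [g])). rewrite <- app_assoc in IH. specialize (IH E).
  rewrite concat_app, dx_app, dy_app in IH. simpl in IH. rewrite app_nil_r in IH.
  simpl. rewrite val_app.
  enough (val (weights m phi) (dx (concat l1)) (dy (concat l1)) g <= 0) by lia.
  rewrite E in Hprod. apply Forall_app in Hprod. destruct Hprod as [H1 H2].
  apply Forall_inv in H2.
  destruct (dx_concat_lattice _ _ _ H1) as (a & Ha).
  assert (Bx := dx_bound (concat l1)). assert (By := dy_bound (concat l1)).
  assert (HB : (length (concat l1) <= length (concat prod))%nat).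
  { rewrite E, concat_app, length_app. lia. }
  rewrite Ha in Bx |- *.
  set (b := dy (concat l1)) in *. clearbody b.
  destruct H2 as [<-|[<-|[<-|[<-|((l & r) & <- & Hr)%in_map_iff]]]].
  - now rewrite val_powX.
  - now rewrite val_powX.
  - simpl. now rewrite weights_lattice.
  - simpl. now rewrite weights_lattice.
  - destruct (Hc l r Hr) as [Hl Hr'].
    unfold rulew. rewrite val_app_closed, val_winv_closed by apply toks_D1.
    simpl. rewrite !val_toks by assumption.
    assert (total phi a b l <= total phi a b r); [|lia].
    apply Hphi; [assumption|nia|lia].
Qed.

Lemma in_submonoid_meq gens u v : meq u v -> in_submonoid gens u -> in_submonoid gens v.
Proof. intros H (l & Hl & K). exists l. split; [assumption|]. now rewrite K. Qed.

Lemma in_submonoid_nil gens : in_submonoid gens [].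
Proof. exists []. split; [constructor|]. reflexivity. Qed.

Lemma in_submonoid_app gens u v :
  in_submonoid gens u -> in_submonoid gens v -> in_submonoid gens (u ++ v).
Proof.
  intros (l & Hl & H) (k & Hk & K). exists (l ++ k). split.
  - now apply Forall_app.
  - now rewrite concat_app, H, K.
Qed.

Lemma in_submonoid_gen gens u : In u gens -> in_submonoid gens u.
Proof. intros H. exists [u]. split; [auto|]. simpl. now rewrite app_nil_r. Qed.

Lemma in_submonoid_pow gens a k z :
  in_submonoid gens (pow a k) -> in_submonoid gens (pow a (- k)) ->
  in_submonoid gens (pow a (k * z)).
Proof.
  assert (H : forall k, in_submonoid gens (pow a k) ->
    forall n, in_submonoid gens (pow a (k * Z.of_nat n))).
  { clear. intros k Hk n. induction n as [|n IH].
    - rewrite Z.mul_0_r. apply in_submonoid_nil.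
    - replace (k * Z.of_nat (S n)) with (k * Z.of_nat n + k) by lia.
      eapply in_submonoid_meq; [symmetry; apply freq_sub_meq, pow_add|].
      now apply in_submonoid_app. }
  intros H1 H2. destruct (Z_lt_le_dec z 0).
  - replace (k * z) with (- k * Z.of_nat (Z.to_nat (- z))) by lia. now apply H.
  - rewrite <- (Z2Nat.id z) by assumption. now apply H.
Qed.

Lemma in_submonoid_lattice m rules a b :
  let w := pow X (Z.of_nat m * a) ++ pow Y b in
  in_submonoid (gens_of m rules) w /\ in_submonoid (gens_of m rules) (winv w).
Proof.
  simpl. rewrite winv_app, <- !pow_opp, !Z.opp_eq_mul_m1, <- !Z.mul_assoc.
  assert (HX : forall z, in_submonoid (gens_of m rules) (pow X (Z.of_nat m * z))).
  { intros z. apply in_submonoid_pow; apply in_submonoid_gen; unfold gens_of; simpl; auto. }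
  assert (HY : forall z, in_submonoid (gens_of m rules) (pow Y z)).
  { intros z. rewrite <- (Z.mul_1_l z).
    apply in_submonoid_pow; apply in_submonoid_gen; unfold gens_of; simpl; auto. }
  split; apply in_submonoid_app; auto.
Qed.

Definition translate (a b : Z) (t : token) : token :=
  let '(c, (a', b')) := t in (c, (a + a', b + b')).

Lemma conj_nil w : freq (conj w []) [].
Proof. grp. Qed.

Lemma conj_app w u v : freq (conj w (u ++ v)) (conj w u ++ conj w v).
Proof. grp. Qed.

Lemma toks_translate m a b S :
  meq (toks m (map (translate a b) S)) (conj (pow X (Z.of_nat m * a) ++ pow Y b) (toks m S)).
Proof.
  induction S as [|(c & a' & b') S IH].
  - simpl. now rewrite conj_nil.
  - change (meq (tokw m (c, (a + a', b + b')) ++ toks m (map (translate a b) S))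
      (conj (pow X (Z.of_nat m * a) ++ pow Y b) (tokw m (c, (a', b')) ++ toks m S))).
    rewrite conj_app, IH.
    enough (H : meq (tokw m (c, (a + a', b + b')))
      (conj (pow X (Z.of_nat m * a) ++ pow Y b) (tokw m (c, (a', b'))))) by now rewrite H.
    unfold tokw.
    transitivity (conj ((pow X (Z.of_nat m * a) ++ pow Y b) ++
      pow X (Z.of_nat m * a') ++ pow Y b') (kap c)).
    + apply conj_ab; [|apply kap_D1].
      rewrite Z.mul_add_distr_l, !pow_add, <- !app_assoc, (app_assoc (pow Y b)).
      rewrite (ab_swap (pow Y b) (pow X _)), <- !app_assoc. reflexivity.
    + apply freq_sub_meq. grp.
Qed.

Lemma toks_perm m S T : Permutation S T -> meq (toks m S) (toks m T).
Proof.
  induction 1 as [|t S T _ IH|s t S|]; simpl.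
  - reflexivity.
  - now rewrite IH.
  - now rewrite !app_assoc, (D1_swap (tokw m t)) by apply tokw_D1.
  - etransitivity; eassumption.
Qed.

Definition member (m : nat) (rules : list rule) (S : list token) : Prop :=
  in_submonoid (gens_of m rules) (toks m S).

Lemma member_nil m rules : member m rules [].
Proof. apply in_submonoid_nil. Qed.

Lemma member_perm m rules S T : Permutation S T -> member m rules S -> member m rules T.
Proof. intros H. apply in_submonoid_meq. now apply toks_perm. Qed.

Lemma member_rule m rules l r a b R : In (l, r) rules ->
  member m rules (map (translate a b) r ++ R) -> member m rules (map (translate a b) l ++ R).
Proof.
  unfold member. intros Hr H.
  destruct (in_submonoid_lattice m rules a b) as [Hw Hw']. simpl in Hw, Hw'.
  assert (HE : in_submonoid (gens_of m rules) (rulew m (l, r))).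
  { apply in_submonoid_gen, in_or_app. right. now apply in_map. }
  assert (K := in_submonoid_app _ _ _ (in_submonoid_app _ _ _ Hw
    (in_submonoid_app _ _ _ HE Hw')) H).
  revert K. apply in_submonoid_meq.
  rewrite !toks_app, !toks_translate. apply freq_sub_meq. unfold rulew. simpl. grp.
Qed.

(** * FRACTRAN programs as token systems *)

(* [fhalt F N l]: the FRACTRAN program [F] halts from the number [N] when only the suffix [l]
   of [F] is left to be tried in the current round. *)
Inductive fhalt (F : list (nat * nat)) : nat -> list (nat * nat) -> Prop :=
| fhalt_nil N : fhalt F N []
| fhalt_hit q d n l : fhalt F (n * q) F -> fhalt F (d * q) ((d, n) :: l)
| fhalt_miss N d n l : ~ Nat.divide d N -> fhalt F N l -> fhalt F N ((d, n) :: l).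

Definition positive (F : list (nat * nat)) : Prop :=
  Forall (fun p => 0 < fst p /\ 0 < snd p)%nat F.

Definition cV : nat := 1.
Definition cW : nat := 2.
Definition cV' : nat := 3.
Definition cW' : nat := 4.
Definition cB : nat := 5.
Definition cA (i : nat) : nat := 6 + 2 * i.
Definition cC (i : nat) : nat := 7 + 2 * i.

Definition at0 (c : nat) : token := (c, (0, 0)).

Definition step_rules (i d n : nat) : list rule :=
  [ ([at0 (cA i)], [(cA i, (- Z.of_nat d, Z.of_nat n))]);
    ([at0 (cA i); at0 cW], [at0 cB]);
    ([at0 (cC i)], [(cC i, (Z.of_nat d, - Z.of_nat n))]);
    ([at0 (cC i); at0 cW'], [at0 (cA (S i))]) ] ++
  map (fun r => ([at0 (cA i); (cW, (- Z.of_nat r, 0))], [at0 (cC i)])) (seq 1 (d - 1)).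

Fixpoint list_rules (i : nat) (F : list (nat * nat)) : list rule :=
  match F with
  | [] => []
  | (d, n) :: F => step_rules i d n ++ list_rules (S i) F
  end.

(* Trying the [i]-th fraction n/d on N, the token [cA i] travels from (N, 0) by steps (-d, n).
   If d divides N it meets the column 0 at (0, nN/d), returns as [cB] along a diagonal
   to (nN/d, 0) and starts a new round; otherwise it may stop at a column 0 < r < d and
   retraces its way as [cC i]. The presence at column 0 and at row 0 is certified by the
   marks [cW] and [cW'], which originate from [cV] and [cV'] and cannot leave these lines. *)
Definition rules_of (F : list (nat * nat)) : list rule :=
  [ ([at0 cV], [(cV, (0, -1)); at0 cW]); ([at0 cV], []); ([at0 cW], [(cW, (0, 1))]);
    ([at0 cV'], [(cV', (-1, 0)); at0 cW']); ([at0 cV'], []); ([at0 cW'], [(cW', (1, 0))]);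
    ([at0 cB], [(cB, (1, -1))]); ([at0 cB; at0 cW'], [at0 (cA 0)]);
    ([at0 (cA (length F))], []) ] ++ list_rules 0 F.

(** The modulus has to exceed every color; the largest one is [cA (length F)], that is 6 + 2 *
    length F. *)
Definition colors (F : list (nat * nat)) : nat := 8 + 2 * length F.

Definition start (N : nat) : list token := [(cA 0, (Z.of_nat N, 0)); at0 cV; at0 cV'].

Lemma in_list_rules F : forall i r, In r (list_rules i F) <->
  exists k d n, nth_error F k = Some (d, n) /\ In r (step_rules (i + k) d n).
Proof.
  induction F as [|(d & n) F IH]; intros i r.
  - split; [intros []|]. intros ([|k] & d & n & H & _); discriminate.
  - change (list_rules i ((d, n) :: F)) with (step_rules i d n ++ list_rules (S i) F).
    rewrite in_app_iff, IH. split.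
    + intros [H|(k & d' & n' & H & K)].
      * exists 0%nat, d, n. now rewrite Nat.add_0_r.
      * exists (S k), d', n'. now rewrite Nat.add_succ_r.
    + intros ([|k] & d' & n' & H & K).
      * left. injection H as <- <-. now rewrite Nat.add_0_r in K.
      * right. exists k, d', n'. now rewrite Nat.add_succ_r in K.
Qed.

Ltac in_cases H :=
  repeat match type of H with
    | _ \/ _ => destruct H as [H|H]
    | False => destruct H
    end.

Ltac colored_tac :=
  repeat (apply Forall_cons; [cbn [fst at0]; unfold cV, cW, cV', cW', cB, cA, cC; lia|]);
  apply Forall_nil.

Lemma rules_colored F l r : In (l, r) (rules_of F) ->
  colored (colors F) l /\ colored (colors F) r.
Proof.
  unfold colored, colors. intros [H|H]%in_app_or.
  - simpl in H.
    in_cases H; injection H as <- <-;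
      split; colored_tac.
  - apply in_list_rules in H. destruct H as (k & d & n & Hk & H).
    assert (k < length F)%nat by (apply nth_error_Some; congruence).
    apply in_app_or in H. destruct H as [H|H].
    + simpl in H.
      in_cases H; injection H as <- <-;
        split; colored_tac.
    + apply in_map_iff in H. destruct H as (x & H & _). injection H as <- <-.
      split; colored_tac.
Qed.

(** * Soundness: a monotone weight for nonhalting programs *)

Definition ind (P : Prop) : Z := if excluded_middle_informative P then 1 else 0.

Lemma ind_le (P Q : Prop) : (P -> Q) -> ind P <= ind Q.
Proof.
  unfold ind. intros H.
  destruct (excluded_middle_informative P), (excluded_middle_informative Q); try lia; tauto.
Qed.

Lemma ind_bounds P : 0 <= ind P <= 1.
Proof. unfold ind. destruct (excluded_middle_informative P); lia. Qed.

Lemma ind_false (P : Prop) : ~ P -> ind P = 0.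
Proof. unfold ind. destruct (excluded_middle_informative P); tauto. Qed.

Lemma ind_true (P : Prop) : P -> ind P = 1.
Proof. unfold ind. destruct (excluded_middle_informative P); tauto. Qed.

(** Points on the walks that belong to nonhalting configurations. The step count [k] is natural here
    and in [goodB], but an integer in [goodC]: the retracing rule lowers [k] and has to be monotone
    even below 0. *)
Definition goodA F i a b : Prop := exists d n N k, nth_error F i = Some (d, n) /\
  ~ fhalt F N (skipn i F) /\
  a = Z.of_nat N - Z.of_nat d * Z.of_nat k /\ b = Z.of_nat n * Z.of_nat k.

Definition goodB F a b : Prop := exists N k, ~ fhalt F N F /\
  a = Z.of_nat k /\ b = Z.of_nat N - Z.of_nat k.

Definition goodC F i a b : Prop := exists d n N k, nth_error F i = Some (d, n) /\
  ~ fhalt F N (skipn (S i) F) /\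
  a = Z.of_nat N - Z.of_nat d * k /\ b = Z.of_nat n * k.

(* Nonhalting configurations have weight 1; marks off their line have weight -1, which
   cancels the gain of a wrongly certified stop; the weight of a source off its line
   decreases with each emission and is nonpositive above -B. *)
Definition potential F (B : Z) (c : nat) (a b : Z) : Z :=
  match c with
  | 0%nat => 0
  | 1%nat => if a =? 0 then 0 else - (b + B)
  | 2%nat => if a =? 0 then 0 else -1
  | 3%nat => if b =? 0 then 0 else - (a + B)
  | 4%nat => if b =? 0 then 0 else -1
  | 5%nat => ind (goodB F a b)
  | S (S (S (S (S (S k))))) =>
      if Nat.even k then ind (goodA F (Nat.div2 k) a b) else ind (goodC F (Nat.div2 k) a b)
  end.

Lemma potential_A F B i a b : potential F B (cA i) a b = ind (goodA F i a b).
Proof.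
  cbn [potential cA Nat.add]. rewrite Nat.even_mul, Nat.div2_double. reflexivity.
Qed.

Lemma potential_C F B i a b : potential F B (cC i) a b = ind (goodC F i a b).
Proof.
  cbn [potential cC Nat.add]. rewrite Nat.even_succ, Nat.odd_mul, Nat.div2_succ_double.
  reflexivity.
Qed.

Lemma skipn_nth_error {T} (l : list T) i x :
  nth_error l i = Some x -> skipn i l = x :: skipn (S i) l.
Proof.
  revert i. induction l as [|y l IH]; intros [|i]; simpl; try discriminate.
  - now intros [= ->].
  - apply IH.
Qed.

Lemma goodA_intro F i N : ~ fhalt F N (skipn i F) -> goodA F i (Z.of_nat N) 0.
Proof.
  intros H. destruct (nth_error F i) as [(d & n)|] eqn:E.
  - exists d, n, N, 0%nat. repeat split; auto; lia.
  - apply nth_error_None in E. destruct H. rewrite skipn_all2 by assumption. constructor.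
Qed.

Lemma goodA_move F i d n a b : nth_error F i = Some (d, n) ->
  goodA F i a b -> goodA F i (a - Z.of_nat d) (b + Z.of_nat n).
Proof.
  intros E (d' & n' & N & k & E' & H & -> & ->). rewrite E in E'. injection E' as <- <-.
  exists d, n, N, (S k). repeat split; auto; lia.
Qed.

Lemma goodA_hit F i d n b : nth_error F i = Some (d, n) ->
  goodA F i 0 b -> goodB F 0 b.
Proof.
  intros E (d' & n' & N & k & E' & H & Ha & ->). rewrite E in E'. injection E' as <- <-.
  exists (n * k)%nat, 0%nat. repeat split; try lia.
  intros K. apply H. rewrite (skipn_nth_error _ _ _ E).
  replace N with (d * k)%nat by lia. now constructor.
Qed.

Lemma goodA_miss F i d n r b : nth_error F i = Some (d, n) -> (0 < r < d)%nat ->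
  goodA F i (Z.of_nat r) b -> goodC F i (Z.of_nat r) b.
Proof.
  intros E Hr (d' & n' & N & k & E' & H & Ha & ->). rewrite E in E'. injection E' as <- <-.
  exists d, n, N, (Z.of_nat k). repeat split; auto.
  intros K. apply H. rewrite (skipn_nth_error _ _ _ E). constructor; [|assumption].
  intros (q & Hq). assert (N = d * k + r)%nat by lia.
  destruct (Nat.le_gt_cases q k); nia.
Qed.

Lemma goodB_move F a b : goodB F a b -> goodB F (a + 1) (b - 1).
Proof.
  intros (N & k & H & -> & ->). exists N, (S k). repeat split; auto; lia.
Qed.

Lemma goodB_stop F a : goodB F a 0 -> goodA F 0 a 0.
Proof.
  intros (N & k & H & -> & Hb). replace k with N by lia. now apply goodA_intro.
Qed.

Lemma goodC_move F i d n a b : nth_error F i = Some (d, n) ->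
  goodC F i a b -> goodC F i (a + Z.of_nat d) (b - Z.of_nat n).
Proof.
  intros E (d' & n' & N & k & E' & H & -> & ->). rewrite E in E'. injection E' as <- <-.
  exists d, n, N, (k - 1). repeat split; auto; lia.
Qed.

(** On row 0 the positive numerator forces k = 0, which pins the returning token to its starting
    point N. *)
Lemma goodC_stop F i a : positive F -> goodC F i a 0 -> goodA F (S i) a 0.
Proof.
  intros HF (d & n & N & k & E & H & -> & Hb).
  assert (Hn : (0 < n)%nat) by apply (proj1 (Forall_forall _ _) HF _ (nth_error_In _ _ E)).
  replace k with 0 by nia. rewrite Z.mul_0_r, Z.sub_0_r. now apply goodA_intro.
Qed.

Lemma potential_step_rules F B i d n l r a b : positive F -> nth_error F i = Some (d, n) ->
  In (l, r) (step_rules i d n) ->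
  total (potential F B) a b l <= total (potential F B) a b r.
Proof.
  intros HF E [H|H]%in_app_or.
  - simpl in H. in_cases H; injection H as <- <-;
      unfold at0; cbn [total]; rewrite ?potential_A, ?potential_C, ?Z.add_0_r.
    + now apply ind_le, goodA_move.
    + cbn [potential cB cW]. destruct (Z.eqb_spec a 0) as [->|].
      * rewrite Z.add_0_r. eapply ind_le, goodA_hit; eassumption.
      * assert (H1 := ind_bounds (goodA F i a b)). assert (H2 := ind_bounds (goodB F a b)). lia.
    + now apply ind_le, goodC_move.
    + cbn [potential cW']. destruct (Z.eqb_spec b 0) as [->|].
      * rewrite Z.add_0_r. apply ind_le. now apply goodC_stop.
      * assert (H1 := ind_bounds (goodC F i a b)).
        assert (H2 := ind_bounds (goodA F (S i) a b)). lia.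
  - apply in_map_iff in H. destruct H as (x & H & Hx%in_seq). injection H as <- <-.
    unfold at0; cbn [total]; rewrite ?potential_A, ?potential_C, ?Z.add_0_r.
    cbn [potential cW]. destruct (Z.eqb_spec (a + - Z.of_nat x) 0).
    + replace a with (Z.of_nat x) by lia. rewrite Z.add_0_r.
      eapply ind_le, goodA_miss; [eassumption|lia].
    + assert (H1 := ind_bounds (goodA F i a b)). assert (H2 := ind_bounds (goodC F i a b)). lia.
Qed.

Lemma potential_rules F B l r a b : positive F -> In (l, r) (rules_of F) ->
  - B <= a -> - B <= b ->
  total (potential F B) a b l <= total (potential F B) a b r.
Proof.
  intros HF [H|H]%in_app_or Ha Hb.
  - simpl in H. in_cases H; injection H as <- <-;
      unfold at0; cbn [total]; rewrite ?potential_A, ?Z.add_0_r;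
      cbn [potential cV cW cV' cW' cB];
      try (destruct (Z.eqb_spec a 0); lia); try (destruct (Z.eqb_spec b 0); lia).
    + apply ind_le, goodB_move.
    + destruct (Z.eqb_spec b 0) as [->|].
      * rewrite Z.add_0_r. apply ind_le, goodB_stop.
      * assert (H1 := ind_bounds (goodB F a b)).
        assert (H2 := ind_bounds (goodA F 0 a b)). lia.
    + rewrite ind_false; [lia|]. intros (d & n & N & k & E & _).
      assert (length F < length F)%nat by (apply nth_error_Some; congruence). lia.
  - apply in_list_rules in H. destruct H as (k & d & n & E & H).
    eapply potential_step_rules; eassumption.
Qed.

(** Both sources sit on their lines in [start N] and weigh 0, so for a nonhalting N the total weight
    is 1, against the bound 0 of [member_total]. *)
Lemma member_fhalt F N : positive F ->
  member (colors F) (rules_of F) (start N) -> fhalt F N F.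
Proof.
  intros HF H. apply NNPP. intros K.
  apply member_total in H; [|unfold colors; lia|apply rules_colored|].
  - destruct H as (B & H). specialize (H (potential F B)).
    assert (total (potential F B) 0 0 (start N) <= 0).
    { apply H. intros. now apply potential_rules. }
    unfold start, at0 in H0. cbn [total] in H0. rewrite potential_A, !Z.add_0_l in H0.
    rewrite ind_true in H0; [simpl in H0; lia|]. now apply goodA_intro.
  - unfold start, colored, colors. colored_tac.
Qed.

(** * Completeness: a halting run empties the configuration *)

Lemma member_step m rules l r l' r' a b R : In (l, r) rules ->
  map (translate a b) l = l' -> map (translate a b) r = r' ->
  member m rules (r' ++ R) -> member m rules (l' ++ R).
Proof. intros H <- <-. now apply member_rule. Qed.

Lemma member_iter m rules c u v : In ([at0 c], [(c, (u, v))]) rules ->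
  forall k a b a' b' R, a' = a + u * Z.of_nat k -> b' = b + v * Z.of_nat k ->
  member m rules ((c, (a', b')) :: R) -> member m rules ((c, (a, b)) :: R).
Proof.
  intros Hin k. induction k as [|k IH]; intros a b a' b' R -> -> H.
  - now rewrite !Z.mul_0_r, !Z.add_0_r in H.
  - apply (member_step _ _ _ _ [(c, (a, b))] [(c, (a + u, b + v))] a b R Hin);
      [simpl; now rewrite !Z.add_0_r|reflexivity|].
    simpl. eapply IH; [| |exact H]; lia.
Qed.

Definition colW (h : nat) : token := (cW, (0, Z.of_nat h)).
Definition rowW (h : nat) : token := (cW', (Z.of_nat h, 0)).

(** [k] counts the emissions made so far: the source is k steps behind the origin, and a mark wanted
    at distance h travels h + k steps. Once all marks of [H] are out, the source is deleted. *)
Lemma member_well m rules cs cm u v (mark : nat -> token) :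
  In ([at0 cs], [(cs, (- u, - v)); at0 cm]) rules -> In ([at0 cs], []) rules ->
  In ([at0 cm], [(cm, (u, v))]) rules ->
  (forall h, mark h = (cm, (u * Z.of_nat h, v * Z.of_nat h))) ->
  forall H k R, member m rules (map mark H ++ R) ->
  member m rules ((cs, (- u * Z.of_nat k, - v * Z.of_nat k)) :: R).
Proof.
  intros H1 H2 H3 Hmark H. induction H as [|h H IH]; intros k R HR.
  - eapply (member_step _ _ _ _ [_] [] _ _ R H2); [|reflexivity|exact HR].
    simpl. rewrite !Z.add_0_r. reflexivity.
  - eapply (member_step _ _ _ _ [_] [_; _] _ _ R H1).
    + simpl. rewrite !Z.add_0_r. reflexivity.
    + simpl. rewrite !Z.add_0_r. reflexivity.
    + simpl.
      replace (- u * Z.of_nat k + - u) with (- u * Z.of_nat (S k)) by lia.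
      replace (- v * Z.of_nat k + - v) with (- v * Z.of_nat (S k)) by lia.
      apply IH.
      eapply member_perm; [apply Permutation_middle|].
      eapply (member_iter _ _ _ _ _ H3 (h + k)); [| |].
      * instantiate (1 := u * Z.of_nat h). lia.
      * instantiate (1 := v * Z.of_nat h). lia.
      * rewrite <- Hmark. exact HR.
Qed.

Lemma in_step_rules F i d n r : nth_error F i = Some (d, n) ->
  In r (step_rules i d n) -> In r (rules_of F).
Proof.
  intros E H. apply in_or_app. right. apply in_list_rules. now exists i, d, n.
Qed.

Lemma nth_error_skipn_cons {T} (F : list T) i x l :
  skipn i F = x :: l -> nth_error F i = Some x /\ skipn (S i) F = l.
Proof.
  revert i. induction F as [|y F IH]; intros [|i]; simpl; try discriminate.
  - intros [= -> ->]. auto.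
  - apply IH.
Qed.

(** Each stop of the token consumes a mark, so the run dictates which ones are needed: heights [H]
    in column 0 and positions [H'] in row 0. They are collected here and supplied by the sources
    afterwards. *)
Lemma member_run F N l : positive F -> fhalt F N l -> forall i, (i <= length F)%nat -> skipn i F = l ->
  exists H H', member (colors F) (rules_of F)
    ((cA i, (Z.of_nat N, 0)) :: map colW H ++ map rowW H').
Proof.
  intros HF. induction 1 as [N|q d n l _ IH|N d n l Hd _ IH]; intros i Hi E.
  - exists [], []. replace i with (length F).
    2: { assert (K := f_equal (@length _) E). rewrite length_skipn in K. simpl in K. lia. }
    eapply (member_step _ _ _ _ [_] [] (Z.of_nat N) 0 []);
      [unfold rules_of; simpl; do 8 right; left; reflexivity
      |simpl; now rewrite !Z.add_0_r|reflexivity|apply member_nil].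
  - destruct (nth_error_skipn_cons _ _ _ _ E) as [E1 E2].
    destruct (IH 0%nat ltac:(lia) eq_refl) as (H & H' & K).
    (* The token walks q steps to (0, nq), is certified there, and descends the diagonal to (nq,
       0). *)
    exists (n * q :: H)%nat, (n * q :: H')%nat. simpl map. simpl app.
    apply (member_iter _ _ (cA i) (- Z.of_nat d) (Z.of_nat n)) with
      (k := q) (a' := 0) (b' := Z.of_nat (n * q)); [|lia|lia|].
    { apply (in_step_rules _ _ _ _ _ E1). left. reflexivity. }
    apply (member_step _ _ [at0 (cA i); at0 cW] [at0 cB]
      [(cA i, (0, Z.of_nat (n * q))); colW (n * q)] [(cB, (0, Z.of_nat (n * q)))]
      0 (Z.of_nat (n * q))).
    { apply (in_step_rules _ _ _ _ _ E1). right. left. reflexivity. }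
    { simpl. rewrite !Z.add_0_r. reflexivity. }
    { simpl. rewrite !Z.add_0_r. reflexivity. }
    apply (member_iter _ _ cB 1 (-1)) with
      (k := (n * q)%nat) (a' := Z.of_nat (n * q)) (b' := 0); [|lia|lia|].
    { do 6 right. left. reflexivity. }
    eapply member_perm; [apply perm_skip, Permutation_middle|].
    apply (member_step _ _ [at0 cB; at0 cW'] [at0 (cA 0)]
      [(cB, (Z.of_nat (n * q), 0)); rowW (n * q)] [(cA 0, (Z.of_nat (n * q), 0))]
      (Z.of_nat (n * q)) 0).
    { do 7 right. left. reflexivity. }
    { simpl. rewrite !Z.add_0_r. reflexivity. }
    { simpl. rewrite !Z.add_0_r. reflexivity. }
    exact K.
  - destruct (nth_error_skipn_cons _ _ _ _ E) as [E1 E2].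
    assert (Hlt : (i < length F)%nat) by (apply nth_error_Some; congruence).
    destruct (IH (S i) ltac:(lia) E2) as (H & H' & K).
    set (q := (N / d)%nat). set (r := (N mod d)%nat).
    assert (HN : N = (d * q + r)%nat) by apply Nat.div_mod_eq.
    assert (Hr : (0 < r < d)%nat).
    { assert (Hd0 : (0 < d)%nat) by apply (proj1 (Forall_forall _ _) HF _ (nth_error_In _ _ E1)).
      assert (r < d)%nat by (apply Nat.mod_upper_bound; lia).
      enough (r <> 0)%nat by lia. intros Hr. destruct Hd. exists q. lia. }
    (* The walk stops after N / d steps in column N mod d and row nq; the way back ends at (N,
       0). *)
    exists (n * q :: H)%nat, (N :: H')%nat. simpl map. simpl app.
    apply (member_iter _ _ (cA i) (- Z.of_nat d) (Z.of_nat n)) with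
      (k := q) (a' := Z.of_nat r) (b' := Z.of_nat (n * q)); [|lia|lia|].
    { apply (in_step_rules _ _ _ _ _ E1). left. reflexivity. }
    apply (member_step _ _ [at0 (cA i); (cW, (- Z.of_nat r, 0))] [at0 (cC i)]
      [(cA i, (Z.of_nat r, Z.of_nat (n * q))); colW (n * q)]
      [(cC i, (Z.of_nat r, Z.of_nat (n * q)))] (Z.of_nat r) (Z.of_nat (n * q))).
    { apply (in_step_rules _ _ _ _ _ E1), in_or_app. right.
      apply in_map_iff. exists r. split; [reflexivity|]. apply in_seq. lia. }
    { simpl. rewrite !Z.add_0_r, Z.add_opp_diag_r. reflexivity. }
    { simpl. rewrite !Z.add_0_r. reflexivity. }
    apply (member_iter _ _ (cC i) (Z.of_nat d) (- Z.of_nat n)) with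
      (k := q) (a' := Z.of_nat N) (b' := 0); [|lia|lia|].
    { apply (in_step_rules _ _ _ _ _ E1). do 2 right. left. reflexivity. }
    eapply member_perm; [apply perm_skip, Permutation_middle|].
    apply (member_step _ _ [at0 (cC i); at0 cW'] [at0 (cA (S i))]
      [(cC i, (Z.of_nat N, 0)); rowW N] [(cA (S i), (Z.of_nat N, 0))] (Z.of_nat N) 0).
    { apply (in_step_rules _ _ _ _ _ E1). do 3 right. left. reflexivity. }
    { simpl. rewrite !Z.add_0_r. reflexivity. }
    { simpl. rewrite !Z.add_0_r. reflexivity. }
    exact K.
Qed.

Lemma fhalt_member F N : positive F ->
  fhalt F N F -> member (colors F) (rules_of F) (start N).
Proof.
  intros HF HN. destruct (member_run _ _ _ HF HN 0 ltac:(lia) eq_refl) as (H & H' & K).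
  unfold start.
  eapply member_perm; [apply (Permutation_app_comm [at0 cV; at0 cV'] [_])|].
  apply (member_well _ _ cV cW 0 1 colW) with (H := H) (k := 0%nat);
    try (unfold rules_of; simpl; tauto).
  { intros h. unfold colW. f_equal. f_equal; lia. }
  eapply member_perm; [apply Permutation_app_comm|].
  apply (member_well _ _ cV' cW' 1 0 rowW) with (H := H') (k := 0%nat);
    try (unfold rules_of; simpl; tauto).
  { intros h. unfold rowW. f_equal. f_equal; lia. }
  eapply member_perm; [apply Permutation_app_comm|]. exact K.
Qed.

Local Close Scope Z_scope.

(** * Counter machines as FRACTRAN programs *)

Fixpoint syl_prod (n : nat) : nat :=
  match n with 0 => 1 | S n => syl_prod n * (1 + syl_prod n) end.

(* Sylvester's sequence 2, 3, 7, 43, ...: a pairwise coprime substitute for the primes. *)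
Definition syl (n : nat) : nat := 1 + syl_prod n.

Lemma syl_dvd_prod i j : i < j -> Nat.divide (syl i) (syl_prod j).
Proof.
  induction 1 as [|j _ IH]; simpl syl_prod.
  - now exists (syl_prod i).
  - now apply Nat.divide_mul_l.
Qed.

Lemma syl_gt1 n : 1 < syl n.
Proof.
  unfold syl. enough (0 < syl_prod n) by lia.
  induction n; simpl; nia.
Qed.

(** For i < j, a common divisor divides both [syl_prod j] and its successor. *)
Lemma syl_coprime i j : i <> j -> Nat.gcd (syl i) (syl j) = 1.
Proof.
  assert (H : forall i j, i < j -> Nat.gcd (syl i) (syl j) = 1).
  { clear. intros i j H. apply Nat.divide_1_r.
    apply Nat.divide_add_cancel_r with (syl_prod j).
    - eapply Nat.divide_trans; [apply Nat.gcd_divide_l|now apply syl_dvd_prod].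
    - rewrite Nat.add_comm. apply Nat.gcd_divide_r. }
  intros Hij. destruct (Nat.lt_ge_cases i j); [now apply H|].
  rewrite Nat.gcd_comm. apply H. lia.
Qed.

Lemma syl_not_dvd_1 k : ~ Nat.divide (syl k) 1.
Proof. intros H%Nat.divide_1_r. assert (K := syl_gt1 k). lia. Qed.

Local Arguments syl : simpl never.
Local Arguments Nat.mul : simpl never.
Local Arguments Nat.pow : simpl never.

Fixpoint regprod (R : nat) (f : regs) : nat :=
  match R with 0 => 1 | S R => regprod R f * syl (2 * R + 1) ^ f R end.

(** Even indices stand for program counters, odd ones for registers. Only one even factor occurs, so
    fractions of other instructions cannot fire. *)
Definition enc (R pc : nat) (f : regs) : nat := syl (2 * pc) * regprod R f.

Lemma syl_dvd_pow k j e x : Nat.divide (syl k) (x * syl j ^ e) -> (k = j -> e = 0) ->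
  Nat.divide (syl k) x.
Proof.
  intros H Hk. induction e as [|e IH].
  - now rewrite Nat.mul_1_r in H.
  - apply IH; [|intros K; specialize (Hk K); discriminate].
    apply Nat.gauss with (syl j).
    + now replace (syl j * (x * syl j ^ e)) with (x * syl j ^ S e)
        by (rewrite Nat.pow_succ_r'; ring).
    + apply syl_coprime. intros K. specialize (Hk K). discriminate.
Qed.

Lemma syl_dvd_regprod k R f : (forall r, r < R -> k = 2 * r + 1 -> f r = 0) ->
  ~ Nat.divide (syl k) (regprod R f).
Proof.
  induction R as [|R IH]; intros Hk H; [now apply syl_not_dvd_1 in H|].
  simpl in H. apply syl_dvd_pow in H; [|intros K; apply Hk; simpl; lia].
  revert H. apply IH. intros r Hr. apply Hk. lia.
Qed.

Lemma syl_dvd_enc k R pc f : k <> 2 * pc -> (forall r, r < R -> k = 2 * r + 1 -> f r = 0) ->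
  ~ Nat.divide (syl k) (enc R pc f).
Proof.
  intros Hpc Hk H. apply Nat.gauss in H; [|now apply syl_coprime].
  revert H. now apply syl_dvd_regprod.
Qed.

Lemma regprod_ext R f g : (forall r, r < R -> f r = g r) -> regprod R f = regprod R g.
Proof.
  induction R as [|R IH]; intros H; simpl; [reflexivity|].
  rewrite IH by auto. now rewrite H by lia.
Qed.

Lemma regprod_upd R f r v : r < R ->
  regprod R (upd f r (S v)) = syl (2 * r + 1) * regprod R (upd f r v).
Proof.
  induction R as [|R IH]; intros Hr; [lia|]. simpl. unfold upd at 2 4.
  destruct (Nat.eqb_spec R r) as [->|].
  - rewrite (regprod_ext r (upd f r (S v)) (upd f r v)).
    + rewrite Nat.pow_succ_r'. ring.
    + intros x Hx. unfold upd. destruct (Nat.eqb_spec x r); [lia|reflexivity].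
  - rewrite IH by lia. ring.
Qed.

Lemma upd_same f r : upd f r (f r) = f.
Proof.
  apply functional_extensionality. intros x. unfold upd.
  now destruct (Nat.eqb_spec x r) as [->|].
Qed.

Definition cstep (p : program) (pc : nat) (f : regs) : option (nat * regs) :=
  match nth_error p pc with
  | None => None
  | Some (INC r) => Some (S pc, upd f r (S (f r)))
  | Some (DECJZ r j) =>
      match f r with
      | 0 => Some (j, f)
      | S k => Some (S pc, upd f r k)
      end
  end.

Inductive crun (p : program) : nat -> regs -> regs -> Prop :=
| crun_stop pc f : cstep p pc f = None -> crun p pc f f
| crun_step pc f pc' f' g : cstep p pc f = Some (pc', f') -> crun p pc' f' g -> crun p pc f g.

Lemma run_crun p fuel : forall pc f g, run p fuel pc f = Some g -> crun p pc f g.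
Proof.
  induction fuel as [|fuel IH]; intros pc f g H; simpl in H;
    destruct (nth_error p pc) as [[r|r j]|] eqn:E; try discriminate;
    try (injection H as <-; apply crun_stop; unfold cstep; now rewrite E).
  - eapply crun_step; [|apply IH, H]. unfold cstep. now rewrite E.
  - destruct (f r) eqn:Er; (eapply crun_step; [|apply IH, H]); unfold cstep; now rewrite E, Er.
Qed.

(** The order performs the zero test: the jump fraction is tried only after the decrement fraction
    has failed. *)
Definition instr_fractions (i : nat) (c : instr) : list (nat * nat) :=
  match c with
  | INC r => [(syl (2 * i), syl (2 * S i) * syl (2 * r + 1))]
  | DECJZ r j => [(syl (2 * i) * syl (2 * r + 1), syl (2 * S i)); (syl (2 * i), syl (2 * j))]
  end.

Fixpoint fractions (i : nat) (p : program) : list (nat * nat) :=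
  match p with
  | [] => []
  | c :: p => instr_fractions i c ++ fractions (S i) p
  end.

Definition uses_below (R : nat) (p : program) : Prop :=
  Forall (fun c => match c with INC r => r < R | DECJZ r _ => r < R end) p.

Lemma uses_below_exists p : exists R, 0 < R /\ uses_below R p.
Proof.
  induction p as [|c p (R & HR & IH)]; [exists 1; split; [lia|constructor]|].
  exists (R + match c with INC r => S r | DECJZ r _ => S r end). split; [lia|].
  constructor; [destruct c; lia|].
  revert IH. apply Forall_impl. intros []; lia.
Qed.

Lemma fractions_positive i p : positive (fractions i p).
Proof.
  unfold positive. revert i. induction p as [|c p IH]; intros i; [constructor|].
  apply Forall_app. split; [|apply IH].
  assert (H : forall k, 0 < syl k) by (intros k; unfold syl; lia).
  destruct c; repeat (apply Forall_cons; [split; apply H || (apply Nat.mul_pos_pos; apply H)|]);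
    constructor.
Qed.

Fixpoint fire (l : list (nat * nat)) (N : nat) : option nat :=
  match l with
  | [] => None
  | (d, n) :: l => if N mod d =? 0 then Some (n * (N / d)) else fire l N
  end.

Lemma fire_hit d n q l : 0 < d -> fire ((d, n) :: l) (d * q) = Some (n * q).
Proof.
  intros Hd. simpl. rewrite (Nat.mul_comm d), Nat.Div0.mod_mul. simpl. now rewrite Nat.div_mul by lia.
Qed.

Lemma fire_miss d n N l : ~ Nat.divide d N -> fire ((d, n) :: l) N = fire l N.
Proof.
  intros H. simpl. destruct (Nat.eqb_spec (N mod d) 0) as [K|K]; [|reflexivity].
  destruct H. now apply Nat.Lcm0.mod_divide.
Qed.

Lemma fire_app l k N :
  fire (l ++ k) N = match fire l N with Some N' => Some N' | None => fire k N end.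
Proof.
  induction l as [|(d & n) l IH]; simpl; [reflexivity|]. now destruct (N mod d =? 0).
Qed.

Lemma fire_instr_other R pc f i c : i <> pc -> fire (instr_fractions i c) (enc R pc f) = None.
Proof.
  intros H.
  assert (Hd : ~ Nat.divide (syl (2 * i)) (enc R pc f)) by (apply syl_dvd_enc; lia).
  destruct c; cbn [instr_fractions]; repeat rewrite fire_miss; try reflexivity; try exact Hd.
  intros K. apply Hd. eapply Nat.divide_trans; [|exact K]. apply Nat.divide_mul_l, Nat.divide_refl.
Qed.

Lemma fire_instr R pc f p c : uses_below R p -> nth_error p pc = Some c ->
  fire (instr_fractions pc c) (enc R pc f) =
  match cstep p pc f with Some (pc', f') => Some (enc R pc' f') | None => None end.
Proof.
  intros HR E. unfold cstep. rewrite E.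
  assert (Hs : forall k, 0 < syl k) by (intros k; unfold syl; lia).
  assert (Hr := proj1 (Forall_forall _ _) HR _ (nth_error_In _ _ E)).
  destruct c as [r|r j]; cbn [instr_fractions]; unfold enc.
  - rewrite fire_hit by apply Hs. rewrite regprod_upd, upd_same by assumption. f_equal. ring.
  - destruct (f r) as [|k] eqn:Er.
    + rewrite fire_miss; [now rewrite fire_hit by apply Hs|]. intros H.
      apply (syl_dvd_enc (2 * r + 1) R pc f); [lia| |].
      * intros x _ Hx. now replace x with r by lia.
      * eapply Nat.divide_trans; [|exact H]. apply Nat.divide_mul_r, Nat.divide_refl.
    + replace (regprod R f) with (syl (2 * r + 1) * regprod R (upd f r k)).
      * rewrite Nat.mul_assoc, fire_hit; [reflexivity|]. now apply Nat.mul_pos_pos.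
      * rewrite <- regprod_upd, <- Er by assumption. now rewrite upd_same.
Qed.

Lemma fire_fractions R p pc f : uses_below R p ->
  fire (fractions 0 p) (enc R pc f) =
  match cstep p pc f with Some (pc', f') => Some (enc R pc' f') | None => None end.
Proof.
  intros HR.
  assert (H : forall q i, (forall k, nth_error q k = nth_error p (i + k)) ->
    fire (fractions i q) (enc R pc f) =
    if i <=? pc
    then match cstep p pc f with Some (pc', f') => Some (enc R pc' f') | None => None end
    else None).
  2: { apply (H p 0). reflexivity. }
  induction q as [|c q IH]; intros i Hq.
  - simpl. destruct (Nat.leb_spec i pc) as [Hi|]; [|reflexivity].
    unfold cstep. specialize (Hq (pc - i)). replace (i + (pc - i)) with pc in Hq by lia.
    rewrite <- Hq. now destruct (pc - i).
  - simpl fractions. rewrite fire_app, (IH (S i)).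
    2: { intros k. rewrite Nat.add_succ_comm. apply (Hq (S k)). }
    specialize (Hq 0). rewrite Nat.add_0_r in Hq.
    destruct (Nat.eq_dec i pc) as [->|Hi].
    + rewrite (fire_instr R pc f p c HR (eq_sym Hq)), Nat.leb_refl.
      replace (S pc <=? pc) with false by (symmetry; apply Nat.leb_gt; lia).
      now destruct (cstep p pc f) as [[]|].
    + rewrite fire_instr_other by assumption.
      destruct (Nat.leb_spec i pc), (Nat.leb_spec (S i) pc); try reflexivity; lia.
Qed.

Lemma fire_fhalt F N N' l : positive l -> fire l N = Some N' -> fhalt F N' F -> fhalt F N l.
Proof.
  intros Hl. induction Hl as [|(d & n) l [Hd Hn] Hl IH]; intros E H; [discriminate|].
  destruct (classic (Nat.divide d N)) as [(q & ->)|Hdiv].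
  - rewrite Nat.mul_comm in *. rewrite fire_hit in E by assumption. injection E as <-.
    now constructor.
  - rewrite fire_miss in E by assumption. constructor; auto.
Qed.

Lemma fire_none_fhalt F N l : positive l -> fire l N = None -> fhalt F N l.
Proof.
  intros Hl. induction Hl as [|(d & n) l [Hd Hn] Hl IH]; intros E; [constructor|].
  destruct (classic (Nat.divide d N)) as [(q & ->)|Hdiv].
  - rewrite Nat.mul_comm, fire_hit in E by assumption. discriminate.
  - rewrite fire_miss in E by assumption. constructor; auto.
Qed.

Lemma crun_fhalt R p pc f g : uses_below R p -> crun p pc f g ->
  fhalt (fractions 0 p) (enc R pc f) (fractions 0 p).
Proof.
  intros HR H. induction H as [pc f H|pc f pc' f' g H _ IH].
  - apply fire_none_fhalt; [apply fractions_positive|].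
    now rewrite fire_fractions, H.
  - eapply fire_fhalt; [apply fractions_positive| |exact IH].
    now rewrite fire_fractions, H.
Qed.

(** The derivation of [fhalt] runs through suffixes [l] of the fractions; the equation on [fire]
    records that those already skipped did not fire. *)
Lemma fhalt_crun R p N l : uses_below R p -> fhalt (fractions 0 p) N l ->
  forall pc f, positive l -> N = enc R pc f -> fire l N = fire (fractions 0 p) N ->
  exists g, crun p pc f g.
Proof.
  intros HR H.
  induction H as [N|q d n l _ IH|N d n l Hd _ IH]; intros pc f Hl E Hf; subst;
    rewrite ?E in Hf; rewrite fire_fractions in Hf by assumption.
  - exists f. apply crun_stop. destruct (cstep p pc f) as [[]|]; [discriminate|reflexivity].
  - rewrite <- E, fire_hit in Hf by apply (Forall_inv Hl).
    destruct (cstep p pc f) as [(pc' & f')|] eqn:Hc; [|discriminate].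
    injection Hf as Hf. destruct (IH pc' f' (fractions_positive _ _) Hf eq_refl) as (g & Hg).
    exists g. eapply crun_step; eassumption.
  - apply (IH pc f (Forall_inv_tail Hl) eq_refl).
    rewrite fire_miss in Hf by assumption. now rewrite fire_fractions.
Qed.

(** 2 is [syl 0], for program counter 0, and 3 is [syl 1], for register 0. *)
Lemma enc_init R n : 0 < R -> enc R 0 (init n) = 2 * 3 ^ n.
Proof.
  intros HR. unfold enc. f_equal. induction HR as [|R HR IH].
  - simpl. apply Nat.add_0_r.
  - simpl regprod. rewrite IH. destruct R; [lia|]. simpl. apply Nat.mul_1_r.
Qed.

Lemma fractions_correct p n :
  (exists g, crun p 0 (init n) g) <-> fhalt (fractions 0 p) (2 * 3 ^ n) (fractions 0 p).
Proof.
  destruct (uses_below_exists p) as (R & HR & Hp).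
  rewrite <- (enc_init R n HR). split.
  - intros (g & Hg). eapply crun_fhalt; eassumption.
  - intros H. apply (fhalt_crun R p _ _ Hp H 0 (init n)); auto using fractions_positive.
Qed.

(** * Structured programs *)

Inductive com : Type :=
| Skip
| Inc (r : nat)
| Seq (c d : com)
| Case (r : nat) (c d : com)
| Loop (r : nat) (c : com).

Declare Scope com_scope.
Delimit Scope com_scope with com.
Notation "c ;; d" := (Seq c d) (at level 80, right associativity) : com_scope.

Inductive exec : com -> regs -> regs -> Prop :=
| exec_skip f : exec Skip f f
| exec_inc r f : exec (Inc r) f (upd f r (S (f r)))
| exec_seq c d f g h : exec c f g -> exec d g h -> exec (Seq c d) f h
| exec_case0 r c d f g : f r = 0 -> exec c f g -> exec (Case r c d) f g
| exec_caseS r c d f g k : f r = S k -> exec d (upd f r k) g -> exec (Case r c d) f g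
| exec_loop0 r c f : f r = 0 -> exec (Loop r c) f f
| exec_loopS r c f g h k : f r = S k -> exec c (upd f r k) g -> exec (Loop r c) g h ->
    exec (Loop r c) f h.

Fixpoint avoids (z : nat) (c : com) : Prop :=
  match c with
  | Skip => True
  | Inc r => r <> z
  | Seq c d => avoids z c /\ avoids z d
  | Case r c d => r <> z /\ avoids z c /\ avoids z d
  | Loop r c => r <> z /\ avoids z c
  end.

Fixpoint clen (c : com) : nat :=
  match c with
  | Skip => 0
  | Inc _ => 1
  | Seq c d => clen c + clen d
  | Case _ c d => 2 + clen d + clen c
  | Loop _ c => 2 + clen c
  end.

(* Jumps are conditional: [z] must hold 0 throughout to make [DECJZ z] unconditional. *)
Fixpoint compile (z base : nat) (c : com) : program :=
  match c with
  | Skip => []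
  | Inc r => [INC r]
  | Seq c d => compile z base c ++ compile z (base + clen c) d
  | Case r c d =>
      DECJZ r (base + (2 + clen d)) ::
      compile z (S base) d ++
      DECJZ z (base + (2 + clen d + clen c)) ::
      compile z (base + (2 + clen d)) c
  | Loop r c => DECJZ r (base + (2 + clen c)) :: compile z (S base) c ++ [DECJZ z base]
  end.

Lemma length_compile z c : forall base, length (compile z base c) = clen c.
Proof.
  induction c; intros base; simpl; rewrite ?length_app; simpl; auto.
  - rewrite IHc2, IHc1. lia.
  - rewrite IHc. lia.
Qed.

Lemma upd_other f r v x : x <> r -> upd f r v x = f x.
Proof. unfold upd. now destruct (Nat.eqb_spec x r). Qed.

Lemma upd_eq f r v : upd f r v r = v.
Proof. unfold upd. now rewrite Nat.eqb_refl. Qed.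

Lemma exec_avoids z c f g : exec c f g -> avoids z c -> g z = f z.
Proof.
  induction 1; simpl; intros Hz; try reflexivity.
  - apply upd_other. auto.
  - rewrite IHexec2, IHexec1; tauto.
  - apply IHexec. tauto.
  - rewrite IHexec by tauto. apply upd_other. intuition.
  - rewrite IHexec2, IHexec1 by (simpl; tauto). apply upd_other. intuition.
Qed.

Inductive csteps (p : program) : nat -> regs -> nat -> regs -> Prop :=
| csteps_refl pc f : csteps p pc f pc f
| csteps_step pc f pc' f' pc'' f'' : cstep p pc f = Some (pc', f') ->
    csteps p pc' f' pc'' f'' -> csteps p pc f pc'' f''.

Lemma csteps_trans p pc f pc' f' pc'' f'' :
  csteps p pc f pc' f' -> csteps p pc' f' pc'' f'' -> csteps p pc f pc'' f''.
Proof. induction 1; intros H1; [assumption|]. eapply csteps_step; eauto. Qed.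

Lemma csteps_crun p pc f pc' f' : csteps p pc f pc' f' ->
  forall g, crun p pc f g <-> crun p pc' f' g.
Proof.
  induction 1 as [|pc f pc' f' pc'' f'' H _ IH]; intros g; [tauto|].
  rewrite <- IH. split; intros K.
  - inversion K; subst; congruence.
  - eapply crun_step; eassumption.
Qed.

(** The machine is deterministic, so a terminating run would pass through every return to [pc0]. The
    induction covers all configurations leading to an [I] state at [pc0]; the explicit first step of
    each cycle makes it progress. *)
Lemma crun_diverges p pc0 (I : regs -> Prop) :
  (forall f, I f -> exists pc' f' g, cstep p pc0 f = Some (pc', f') /\
     csteps p pc' f' pc0 g /\ I g) ->
  forall f g, I f -> ~ crun p pc0 f g.
Proof.
  intros HI.
  enough (H : forall pc f g, crun p pc f g -> forall h, csteps p pc f pc0 h -> I h -> False).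
  { intros f g Hf K. apply (H _ _ _ K f); [constructor|assumption]. }
  intros pc f g. induction 1 as [pc f Hs|pc f pc' f' g Hs _ IH]; intros h K Hh;
    inversion K; subst; try congruence;
    try (destruct (HI h Hh) as (pc1 & f1 & g1 & H1 & H2 & H3); try congruence).
  - rewrite Hs in H1. injection H1 as <- <-. exact (IH g1 H2 H3).
  - rewrite Hs in H. injection H as <- <-. exact (IH h H0 Hh).
Qed.

Definition placed (p : program) (base : nat) (q : program) : Prop :=
  forall k i, nth_error q k = Some i -> nth_error p (base + k) = Some i.

Lemma placed_app p base q q' :
  placed p base (q ++ q') <-> placed p base q /\ placed p (base + length q) q'.
Proof.
  unfold placed. split.
  - intros H. split; intros k i Hk.
    + apply H. rewrite nth_error_app1; [assumption|]. apply nth_error_Some. congruence.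
    + rewrite <- Nat.add_assoc. apply H. rewrite nth_error_app2 by lia.
      now replace (length q + k - length q) with k by lia.
  - intros [H1 H2] k i Hk. destruct (Nat.lt_ge_cases k (length q)).
    + apply H1. now rewrite nth_error_app1 in Hk.
    + rewrite nth_error_app2 in Hk by assumption. apply H2 in Hk.
      now replace (base + length q + (k - length q)) with (base + k) in Hk by lia.
Qed.

Lemma placed_cons p base i q :
  placed p base (i :: q) <-> nth_error p base = Some i /\ placed p (S base) q.
Proof.
  change (i :: q) with ([i] ++ q). rewrite placed_app. simpl.
  rewrite (Nat.add_1_r base). apply and_iff_compat_r. unfold placed. split.
  - intros H. rewrite <- (Nat.add_0_r base). now apply H.
  - intros H [|k] j Hk; [|destruct k; discriminate]. injection Hk as <-.
    now rewrite Nat.add_0_r.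
Qed.

Lemma csteps_jump p z pc j f pc' f' : nth_error p pc = Some (DECJZ z j) -> f z = 0 ->
  csteps p j f pc' f' -> csteps p pc f pc' f'.
Proof.
  intros E H. apply csteps_step. unfold cstep. now rewrite E, H.
Qed.

Lemma csteps_dec p r pc j f k pc' f' : nth_error p pc = Some (DECJZ r j) -> f r = S k ->
  csteps p (S pc) (upd f r k) pc' f' -> csteps p pc f pc' f'.
Proof.
  intros E H. apply csteps_step. unfold cstep. now rewrite E, H.
Qed.

Lemma compile_correct p z c f g : exec c f g -> avoids z c -> f z = 0 ->
  forall base, placed p base (compile z base c) -> csteps p base f (base + clen c) g.
Proof.
  induction 1 as [f|r f|c d f g h Hc IHc Hd IHd|r c d f g Hr Hc IHc|r c d f g k Hr Hd IHd
    |r c f Hr|r c f g h k Hr Hc IHc Hl IHl]; simpl; intros Hz Hf base Hp.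
  - rewrite Nat.add_0_r. constructor.
  - apply placed_cons in Hp. destruct Hp as [Hp _].
    eapply csteps_step; [unfold cstep; now rewrite Hp|].
    rewrite Nat.add_1_r. constructor.
  - apply placed_app in Hp. rewrite length_compile in Hp. destruct Hp as [H1 H2].
    eapply csteps_trans; [now apply IHc|]. rewrite Nat.add_assoc.
    apply IHd; try tauto. rewrite (exec_avoids z c f g); tauto.
  - apply placed_cons in Hp. destruct Hp as [H1 Hp].
    apply placed_app in Hp. rewrite length_compile in Hp. destruct Hp as [_ Hp].
    apply placed_cons in Hp. destruct Hp as [_ Hp].
    eapply csteps_jump; [exact H1|assumption|].
    replace (base + S (S (clen d + clen c))) with (base + S (S (clen d)) + clen c) by lia.
    apply IHc; try tauto.
    now replace (S (S base + clen d)) with (base + S (S (clen d))) in Hp by lia.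
  - apply placed_cons in Hp. destruct Hp as [H1 Hp].
    apply placed_app in Hp. rewrite length_compile in Hp. destruct Hp as [H2 Hp].
    apply placed_cons in Hp. destruct Hp as [H3 _].
    assert (Hf' : upd f r k z = 0) by (rewrite upd_other; intuition).
    eapply csteps_dec; [exact H1|exact Hr|].
    eapply csteps_trans; [apply IHd; tauto|].
    eapply csteps_jump; [exact H3| |constructor].
    rewrite (exec_avoids z d (upd f r k) g); tauto.
  - apply placed_cons in Hp. destruct Hp as [H1 _].
    eapply csteps_jump; [exact H1|assumption|constructor].
  - assert (Hp' := Hp). apply placed_cons in Hp. destruct Hp as [H1 Hp].
    apply placed_app in Hp. rewrite length_compile in Hp. destruct Hp as [H2 Hp].
    apply placed_cons in Hp. destruct Hp as [H3 _].
    assert (Hf' : upd f r k z = 0) by (rewrite upd_other; intuition).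
    assert (Hg : g z = 0) by (rewrite (exec_avoids z c (upd f r k) g); tauto).
    eapply csteps_dec; [exact H1|exact Hr|].
    eapply csteps_trans; [apply IHc; tauto|].
    eapply csteps_jump; [exact H3|exact Hg|]. apply IHl; simpl; tauto.
Qed.

(* One iteration of a compiled loop takes at least one machine step. *)
Lemma loop_diverges p z base r c (I : regs -> Prop) :
  placed p base (compile z base (Loop r c)) -> avoids z (Loop r c) ->
  (forall f, I f -> f z = 0 /\ exists k g, f r = S k /\ exec c (upd f r k) g /\ I g) ->
  forall f g, I f -> ~ crun p base f g.
Proof.
  intros Hp Hz HI. apply crun_diverges. intros f Hf.
  destruct (HI f Hf) as (Hf0 & k & g & Hr & Hc & Hg).
  simpl in Hp, Hz. apply placed_cons in Hp. destruct Hp as [H1 Hp].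
  apply placed_app in Hp. rewrite length_compile in Hp. destruct Hp as [H2 Hp].
  apply placed_cons in Hp. destruct Hp as [H3 _].
  assert (Hf' : upd f r k z = 0) by (rewrite upd_other; intuition).
  exists (S base), (upd f r k), g. split; [|split; [|exact Hg]].
  - unfold cstep. now rewrite H1, Hr.
  - eapply csteps_trans; [eapply compile_correct; try eassumption; tauto|].
    eapply csteps_jump; [exact H3|apply (HI g Hg)|constructor].
Qed.

(** * Register states as lists *)

Definition st (l : list nat) : regs := fun r => nth r l 0.

Fixpoint setn (r v : nat) (l : list nat) : list nat :=
  match r, l with
  | 0, [] => [v]
  | 0, _ :: l => v :: l
  | S r, [] => 0 :: setn r v []
  | S r, a :: l => a :: setn r v l
  end.

Lemma upd_st l r v : upd (st l) r v = st (setn r v l).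
Proof.
  apply functional_extensionality. intros x. unfold upd, st.
  revert r l. induction x as [|x IH]; intros [|r] [|a l]; simpl; try reflexivity.
  - now destruct x.
  - rewrite <- IH. now destruct (x =? r), x.
  - apply IH.
Qed.

Fixpoint incs (ts : list nat) : com :=
  match ts with [] => Skip | t :: ts => Seq (Inc t) (incs ts) end.

(** A target listed several times receives a multiple of [r]; the empty list just clears [r]. *)
Definition mv (r : nat) (ts : list nat) : com := Loop r (incs ts).

Fixpoint adds (ts : list nat) (n : nat) (f : regs) : regs :=
  match ts with [] => f | t :: ts => adds ts n (upd f t (f t + n)) end.

Fixpoint ladds (ts : list nat) (n : nat) (l : list nat) : list nat :=
  match ts with [] => l | t :: ts => ladds ts n (setn t (nth t l 0 + n) l) end.

Lemma adds_count ts n : forall f x, adds ts n f x = f x + n * count_occ Nat.eq_dec ts x.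
Proof.
  induction ts as [|t ts IH]; intros f x; simpl; [lia|].
  rewrite IH. unfold upd. destruct (Nat.eqb_spec x t), (Nat.eq_dec t x); subst; try lia; try tauto.
Qed.

Lemma adds_st ts n : forall l, adds ts n (st l) = st (ladds ts n l).
Proof.
  induction ts as [|t ts IH]; intros l; simpl; [reflexivity|]. now rewrite upd_st, IH.
Qed.

Lemma exec_incs ts : forall f, exec (incs ts) f (adds ts 1 f).
Proof.
  induction ts as [|t ts IH]; intros f; simpl; [constructor|].
  eapply exec_seq; [apply exec_inc|]. rewrite Nat.add_1_r. apply IH.
Qed.

Lemma exec_mv r ts f : ~ In r ts -> exec (mv r ts) f (upd (adds ts (f r) f) r 0).
Proof.
  intros Hr. assert (Hc := proj1 (count_occ_not_In Nat.eq_dec ts r) Hr).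
  remember (f r) as n eqn:E. symmetry in E. revert f E. induction n as [|n IH]; intros f E.
  - replace (upd (adds ts 0 f) r 0) with f; [now apply exec_loop0|].
    apply functional_extensionality. intros x. unfold upd.
    destruct (Nat.eqb_spec x r) as [->|]; [assumption|]. rewrite adds_count. lia.
  - eapply exec_loopS; [exact E|apply exec_incs|].
    replace (upd (adds ts (S n) f) r 0) with (upd (adds ts n (adds ts 1 (upd f r n))) r 0).
    + apply IH. rewrite adds_count, upd_eq, Hc. lia.
    + apply functional_extensionality. intros x. unfold upd at 1 3.
      destruct (Nat.eqb_spec x r) as [->|]; [reflexivity|].
      rewrite !adds_count, upd_other by assumption. lia.
Qed.

Lemma exec_mv_st r ts l : ~ In r ts ->
  exec (mv r ts) (st l) (st (setn r 0 (ladds ts (nth r l 0) l))).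
Proof.
  intros H. generalize (exec_mv r ts (st l) H). now rewrite adds_st, upd_st.
Qed.

Lemma exec_inc_st r l : exec (Inc r) (st l) (st (setn r (S (nth r l 0)) l)).
Proof. generalize (exec_inc r (st l)). now rewrite upd_st. Qed.

Lemma exec_loopS_st r c l g h k : nth r l 0 = S k ->
  exec c (st (setn r k l)) g -> exec (Loop r c) g h -> exec (Loop r c) (st l) h.
Proof. rewrite <- (upd_st l r k). exact (exec_loopS r c (st l) g h k). Qed.

Lemma exec_caseS_st r c d l g k : nth r l 0 = S k ->
  exec d (st (setn r k l)) g -> exec (Case r c d) (st l) g.
Proof. rewrite <- (upd_st l r k). exact (exec_caseS r c d (st l) g k). Qed.

(** * An interpreter for FRACTRAN programs *)

Lemma exec_to c f g g' : exec c f g -> g = g' -> exec c f g'.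
Proof. now intros H <-. Qed.

Ltac mv_side := simpl; intuition discriminate.
Ltac xinc := eapply exec_seq; [apply exec_inc_st|cbn [setn nth]].
Ltac xmv := eapply exec_seq; [apply exec_mv_st; mv_side|cbn [setn nth ladds]].
Ltac same := repeat apply (f_equal2 (@cons nat)); try reflexivity; try lia.
Ltac done_mv := eapply exec_to; [apply exec_mv_st; mv_side|cbn [setn nth ladds]; apply f_equal; same].
Ltac xset l' := match goal with |- exec _ (st ?l) _ => replace l with l' by same end.

(* Registers: 0 dividend, 1 divisor (counting down), 2 remainder, 3 quotient, 4 code of the
   fractions left to try, 5 current number, 6 code of the program, 7 and 8 current fraction,
   9 scratch, 10 loop flag. *)
Definition divide : com :=
  Loop 0 (Inc 2 ;; Case 1 Skip Skip ;; Case 1 (Inc 3 ;; mv 2 [1]) (Inc 1))%com.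

(** Registers 1 and 2 always sum to the divisor, here S g + e. In the loop body the first [Case] is
    a bare decrement; the second tests for 0 and either reloads the divisor from the remainder or
    undoes its own decrement. *)
Lemma exec_divide i : forall g e q rest,
  exec divide (st (i :: S g :: e :: q :: rest))
    (st (0 :: (S g + e) - (e + i) mod (S g + e) :: (e + i) mod (S g + e) ::
         q + (e + i) / (S g + e) :: rest)).
Proof.
  induction i as [|i IH]; intros g e q rest.
  - eapply exec_to; [now apply exec_loop0|]. rewrite Nat.add_0_r.
    rewrite Nat.mod_small, Nat.div_small by lia. apply f_equal. same.
  - destruct g as [|g]; (eapply exec_loopS_st; [reflexivity| |]).
    + cbn [setn]. xinc. eapply exec_seq; [eapply exec_caseS_st; [reflexivity|constructor]|].
      cbn [setn]. apply exec_case0; [reflexivity|]. xinc. apply exec_mv_st. mv_side.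
    + cbn [setn nth ladds]. eapply exec_to; [apply IH|].
      replace (S e + 0) with (1 + e) by lia.
      replace (e + S i) with (0 + i + 1 * (1 + e)) by lia.
      rewrite Nat.Div0.mod_add, Nat.div_add by lia. apply f_equal. same.
    + cbn [setn]. xinc. eapply exec_seq; [eapply exec_caseS_st; [reflexivity|constructor]|].
      cbn [setn]. eapply exec_caseS_st; [reflexivity|]. apply exec_inc_st.
    + cbn [setn nth ladds]. eapply exec_to; [apply IH|].
      replace (S e + i) with (e + S i) by lia.
      replace (S g + S e) with (S (S g) + e) by lia. reflexivity.
Qed.

(** In binary, from the lowest bit: k ones, a zero, then t. Such blocks are read by halving, and
    since denominators are positive, code 0 means that no fraction is left. *)
Fixpoint ones (k t : nat) : nat :=
  match k with 0 => 2 * t | S k => 1 + 2 * ones k t end.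

Fixpoint code (F : list (nat * nat)) : nat :=
  match F with [] => 0 | (d, n) :: F => ones d (ones n (code F)) end.

Definition read_body (r : nat) : com :=
  (mv 4 [0] ;; Inc 1 ;; Inc 1 ;; divide ;; Case 2 Skip (Inc r ;; Inc 10) ;;
   mv 3 [4] ;; mv 1 [])%com.

Definition read (r : nat) : com := (Inc 10 ;; Loop 10 (read_body r))%com.

Lemma exec_halve x b rest : b < 2 ->
  exec divide (st (2 * x + b :: 2 :: 0 :: 0 :: rest)) (st (0 :: 2 - b :: b :: x :: rest)).
Proof.
  intros Hb. eapply exec_to; [apply exec_divide|].
  replace (1 + 1 + 0) with 2 by lia. replace (0 + (2 * x + b)) with (b + x * 2) by lia.
  rewrite Nat.Div0.mod_add, Nat.div_add by lia.
  rewrite Nat.mod_small, Nat.div_small by lia. reflexivity.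
Qed.

Lemma exec_read r k t N c d n : r = 7 \/ r = 8 ->
  exec (read r) (st [0; 0; 0; 0; ones k t; N; c; d; n; 0; 0])
    (st (ladds [r] k [0; 0; 0; 0; t; N; c; d; n; 0; 0])).
Proof.
  intros Hr. xinc. revert d n. induction k as [|k IH]; intros d n; cbn [ones].
  - eapply exec_loopS_st; [reflexivity| |now apply exec_loop0; destruct Hr as [-> | ->]].
    cbn [setn]. unfold read_body. xmv. xinc. xinc.
    xset [2 * t + 0; 2; 0; 0; 0; N; c; d; n; 0; 0].
    eapply exec_seq; [apply exec_halve; lia|].
    eapply exec_seq; [apply exec_case0; [reflexivity|constructor]|].
    destruct Hr as [-> | ->]; xmv; done_mv.
  - destruct Hr as [-> | ->]; (eapply exec_loopS_st; [reflexivity| |]);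
      try (cbn [setn]; unfold read_body; xmv; xinc; xinc;
        xset [2 * ones k t + 1; 2; 0; 0; 0; N; c; d; n; 0; 0];
        eapply exec_seq; [apply exec_halve; lia|];
        eapply exec_seq;
          [eapply exec_caseS_st; [reflexivity|]; cbn [setn]; xinc; apply exec_inc_st|];
        cbn [setn nth]; xmv; apply exec_mv_st; mv_side);
      cbn [setn nth ladds];
      match goal with |- exec _ (st [_; _; _; _; _; _; _; ?d'; ?n'; _; _]) _ =>
        xset [0; 0; 0; 0; ones k t; N; c; d'; n'; 0; 1] end;
      (eapply exec_to; [apply IH|]); cbn [setn nth ladds]; apply f_equal; same.
Qed.

Definition mul_add (r : nat) : com := Loop 3 (mv r [5; 9] ;; mv 9 [r])%com.

Lemma exec_mul_add r q : r = 1 \/ r = 8 -> forall g t N c d n,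
  let l := [0; g; 0; q; t; N; c; d; n; 0; 0] in
  exec (mul_add r) (st l) (st [0; g; 0; 0; t; N + q * nth r l 0; c; d; n; 0; 0]).
Proof.
  intros Hr. induction q as [|q IH]; intros g t N c d n l; subst l.
  - eapply exec_to; [now apply exec_loop0|]. apply f_equal. same.
  - destruct Hr as [-> | ->]; (eapply exec_loopS_st; [reflexivity| |]).
    + cbn [setn]. xmv. apply exec_mv_st. mv_side.
    + cbn [setn nth ladds]. xset [0; g; 0; q; t; N + g; c; d; n; 0; 0].
      eapply exec_to; [apply IH|]. cbn [nth]. apply f_equal. same.
    + cbn [setn]. xmv. apply exec_mv_st. mv_side.
    + cbn [setn nth ladds]. xset [0; g; 0; q; t; N + n; c; d; n; 0; 0].
      eapply exec_to; [apply IH|]. cbn [nth]. apply f_equal. same.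
Qed.

(** [Inc 4] undoes the decrement of the enclosing loop. After a hit, the program code is restored
    from register 6. After a miss, register 1 holds d minus the remainder, so adding the remainder
    to registers 1 and 5 recovers d, and then N as quotient times d plus remainder. *)
Definition round : com :=
  (Inc 4 ;; read 7 ;; read 8 ;; mv 5 [0] ;; mv 7 [1] ;; divide ;;
   Case 2
     (mul_add 8 ;; mv 1 [] ;; mv 8 [] ;; mv 4 [] ;; mv 6 [4; 9] ;; mv 9 [6])
     (Inc 2 ;; mv 2 [5; 1] ;; mul_add 1 ;; mv 1 [] ;; mv 8 []))%com.

Definition interp_state (N t c : nat) : regs := st [0; 0; 0; 0; t; N; c; 0; 0; 0; 0].

Lemma exec_round_prefix d n F N c k h : 0 < d -> code ((d, n) :: F) = S k ->
  (exec (Case 2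
     (mul_add 8 ;; mv 1 [] ;; mv 8 [] ;; mv 4 [] ;; mv 6 [4; 9] ;; mv 9 [6])
     (Inc 2 ;; mv 2 [5; 1] ;; mul_add 1 ;; mv 1 [] ;; mv 8 []))%com
     (st [0; d - N mod d; N mod d; N / d; code F; 0; c; 0; n; 0; 0]) h) ->
  exec round (interp_state N k c) h.
Proof.
  intros Hd Hk H. unfold round, interp_state. xinc. rewrite <- Hk. cbn [code].
  eapply exec_seq; [apply exec_read; auto|]. eapply exec_seq; [apply exec_read; auto|].
  xmv. xmv. destruct d as [|d]; [lia|].
  xset [N; S d; 0; 0; code F; 0; c; 0; n; 0; 0].
  eapply exec_seq; [apply exec_divide|].
  rewrite Nat.add_0_r. exact H.
Qed.

Lemma exec_round_hit d n F q c k : 0 < d -> code ((d, n) :: F) = S k ->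
  exec round (interp_state (d * q) k c) (interp_state (n * q) c c).
Proof.
  intros Hd Hk. eapply exec_round_prefix; try eassumption. unfold interp_state.
  rewrite (Nat.mul_comm d), Nat.Div0.mod_mul, Nat.div_mul, Nat.sub_0_r by lia.
  apply exec_case0; [reflexivity|].
  eapply exec_seq; [apply exec_mul_add; auto|].
  xmv. xmv. xmv. xmv. done_mv.
Qed.

Lemma exec_round_miss d n F N c k : 0 < d -> code ((d, n) :: F) = S k ->
  ~ Nat.divide d N -> exec round (interp_state N k c) (interp_state N (code F) c).
Proof.
  intros Hd Hk HN. eapply exec_round_prefix; try eassumption. unfold interp_state.
  assert (Hr : N mod d <> 0) by (intros E; now apply HN, Nat.Lcm0.mod_divide).
  assert (Hlt : N mod d < d) by (apply Nat.mod_upper_bound; lia).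
  assert (E := Nat.div_mod_eq N d).
  set (q := N / d) in *. set (r := N mod d) in *. clearbody q r.
  destruct r as [|r]; [lia|].
  eapply exec_caseS_st; [reflexivity|]. cbn [setn]. xinc. xmv.
  xset [0; d; 0; q; code F; S r; c; 0; n; 0; 0].
  eapply exec_seq; [apply exec_mul_add; auto|].
  xmv. done_mv.
Qed.

Lemma ones_pos k t : 0 < k -> 0 < ones k t.
Proof. destruct k; simpl; lia. Qed.

Lemma exec_rounds F : positive F -> forall N l, fhalt F N l -> positive l ->
  exists h, exec (Loop 4 round) (interp_state N (code l) (code F)) h.
Proof.
  intros HF N l. induction 1 as [N|q d n l _ IH|N d n l Hd _ IH]; intros Hl.
  - eexists. now apply exec_loop0.
  - destruct (IH HF) as (h & Hh). exists h.
    destruct (Forall_inv Hl) as [Hd0 Hn0]. simpl in Hd0.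
    assert (K := ones_pos d (ones n (code l)) Hd0).
    destruct (code ((d, n) :: l)) as [|k] eqn:E; [simpl in E; lia|].
    eapply exec_loopS_st; [reflexivity| |exact Hh].
    now apply (exec_round_hit d n l).
  - destruct (IH (Forall_inv_tail Hl)) as (h & Hh). exists h.
    destruct (Forall_inv Hl) as [Hd0 Hn0]. simpl in Hd0.
    assert (K := ones_pos d (ones n (code l)) Hd0).
    destruct (code ((d, n) :: l)) as [|k] eqn:E; [simpl in E; lia|].
    eapply exec_loopS_st; [reflexivity| |exact Hh].
    now apply (exec_round_miss d n l).
Qed.

(** The input n is used twice: as program code, in registers 4 and 6, and as exponent of the
    starting number 2 * 3 ^ n, counted by register 9. *)
Definition interp_init : com :=
  (mv 0 [4; 6; 9] ;; Inc 5 ;; Inc 5 ;; Loop 9 (mv 5 [0; 0; 0] ;; mv 0 [5]))%com.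

Lemma init_st n k : init n = st (n :: repeat 0 k).
Proof.
  apply functional_extensionality. intros [|x]; [reflexivity|].
  unfold init, st. simpl. symmetry. apply nth_repeat.
Qed.

Lemma exec_interp_init n : exec interp_init (init n) (interp_state (2 * 3 ^ n) n n).
Proof.
  rewrite (init_st n 10). simpl repeat. unfold interp_init, interp_state.
  xmv. xinc. xinc.
  assert (H : forall k N, exec (Loop 9 (mv 5 [0; 0; 0] ;; mv 0 [5]))%com
    (st [0; 0; 0; 0; n; N; n; 0; 0; k; 0]) (st [0; 0; 0; 0; n; N * 3 ^ k; n; 0; 0; 0; 0])).
  { induction k as [|k IH]; intros N.
    - eapply exec_to; [now apply exec_loop0|]. rewrite Nat.pow_0_r. apply f_equal. same.
    - eapply exec_loopS_st; [reflexivity| |].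
      + cbn [setn]. xmv. apply exec_mv_st. mv_side.
      + cbn [setn nth ladds]. xset [0; 0; 0; 0; n; 3 * N; n; 0; 0; k; 0].
        eapply exec_to; [apply IH|]. rewrite Nat.pow_succ_r'. apply f_equal. same. }
  apply H.
Qed.

(** Only runs of a program on its own code are interpreted, which is all the diagonal argument asks
    for. Register 11 is untouched by the interpreter and is the constant 0 of compiled jumps. *)
Lemma universal_program : exists p, forall F, positive F ->
  ((exists g, crun p 0 (init (code F)) g) <-> fhalt F (2 * 3 ^ code F) F).
Proof.
  set (p := compile 11 0 (interp_init ;; Loop 4 round)%com).
  exists p. intros F HF.
  assert (Hz : avoids 11 interp_init /\ avoids 11 (Loop 4 round)).
  { simpl. intuition discriminate. }
  assert (Hp : placed p 0 (compile 11 0 interp_init) /\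
    placed p (clen interp_init) (compile 11 (clen interp_init) (Loop 4 round))).
  { rewrite <- (length_compile 11 interp_init 0) at 1.
    apply (placed_app p 0). intros k i H. exact H. }
  destruct Hp as [Hp1 Hp2].
  assert (H0 := compile_correct p 11 _ _ _ (exec_interp_init (code F))
    (proj1 Hz) eq_refl 0 Hp1).
  split.
  - intros (g & Hg). rewrite (csteps_crun _ _ _ _ _ H0) in Hg.
    apply NNPP. intros HN. revert Hg.
    (* Invariant of the main loop: the interpreted configuration does not halt. *)
    apply (loop_diverges p 11 _ 4 round (fun f => exists N l, positive l /\
      f = interp_state N (code l) (code F) /\ ~ fhalt F N l)); auto; [tauto| |].
    2: { exists (2 * 3 ^ code F), F. auto. }
    intros f (N & l & Hl & -> & Hf). split; [reflexivity|].
    destruct l as [|(d & n) l]; [destruct Hf; constructor|].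
    destruct (Forall_inv Hl) as [Hd0 Hn0]. simpl in Hd0.
    assert (K := ones_pos d (ones n (code l)) Hd0).
    destruct (code ((d, n) :: l)) as [|k] eqn:E; [simpl in E; lia|].
    exists k. unfold interp_state at 1 2. rewrite upd_st. cbn [setn].
    destruct (classic (Nat.divide d N)) as [(q & ->)|Hdiv].
    + exists (interp_state (n * q) (code F) (code F)). split; [reflexivity|]. split.
      * rewrite (Nat.mul_comm q). now apply (exec_round_hit d n l).
      * exists (n * q), F. repeat split; auto. intros K'. apply Hf.
        rewrite (Nat.mul_comm q). now constructor.
    + exists (interp_state N (code l) (code F)). split; [reflexivity|]. split.
      * now apply (exec_round_miss d n l).
      * exists N, l. repeat split; auto; [exact (Forall_inv_tail Hl)|].
        intros K'. apply Hf. now constructor.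
  - intros H. destruct (exec_rounds F HF _ _ H HF) as (h & Hh).
    exists h. rewrite (csteps_crun _ _ _ _ _ H0).
    rewrite (csteps_crun _ _ _ _ _
      (compile_correct p 11 _ _ _ Hh (proj2 Hz) eq_refl _ Hp2)).
    apply crun_stop. unfold cstep.
    replace (nth_error p _) with (@None instr); [reflexivity|].
    symmetry. apply nth_error_None. unfold p. rewrite length_compile. simpl. lia.
Qed.

(** * Diagonalization *)

Definition push (a : letter) : com := (mv 1 [2; 2; 2; 2; 2] ;; incs (repeat 2 (lcode a)) ;; mv 2 [1])%com.

Fixpoint push_word (w : word) : com :=
  match w with [] => Skip | a :: w => (push_word w ;; push a)%com end.

Lemma exec_push a x v rest :
  exec (push a) (st (x :: v :: 0 :: rest)) (st (x :: lcode a + 5 * v :: 0 :: rest)).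
Proof.
  unfold push. xmv. eapply exec_seq; [apply exec_incs|].
  rewrite adds_st. destruct a; cbn [lcode repeat ladds setn nth]; done_mv.
Qed.

Lemma exec_push_word w u x rest :
  exec (push_word w) (st (x :: wcode u :: 0 :: rest)) (st (x :: wcode (w ++ u) :: 0 :: rest)).
Proof.
  induction w as [|a w IH]; [constructor|].
  simpl push_word. eapply exec_seq; [exact IH|]. apply exec_push.
Qed.

(** Letters are pushed on the left, so the factors are written last to first. The number 2 * 3 ^ n
    moves from register 3 to 4 during the first power, to be available for the second. *)
Definition encode (k : nat) (u v : word) : com :=
  (Inc 3 ;; Inc 3 ;; Loop 0 (mv 3 [2; 2; 2] ;; mv 2 [3]) ;;
   push_word v ;; Loop 3 (Inc 4 ;; push_word (repeat Xi k)) ;;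
   push_word u ;; Loop 4 (push_word (repeat X k)) ;; mv 1 [0])%com.

Lemma exec_encode k u v n : exec (encode k u v) (init n)
  (init (wcode (repeat X (k * (2 * 3 ^ n)) ++ u ++ repeat Xi (k * (2 * 3 ^ n)) ++ v))).
Proof.
  rewrite (init_st n 4), (init_st _ 4). simpl repeat at 1 4. unfold encode.
  xinc. xinc.
  assert (H1 : forall n N, exec (Loop 0 (mv 3 [2; 2; 2] ;; mv 2 [3]))%com
    (st [n; 0; 0; N; 0]) (st [0; 0; 0; N * 3 ^ n; 0])).
  { clear n. induction n as [|n IH]; intros N.
    - eapply exec_to; [now apply exec_loop0|]. rewrite Nat.pow_0_r. apply f_equal. same.
    - eapply exec_loopS_st; [reflexivity| |].
      + cbn [setn]. xmv. apply exec_mv_st. mv_side.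
      + cbn [setn nth ladds]. xset [n; 0; 0; 3 * N; 0].
        eapply exec_to; [apply IH|]. rewrite Nat.pow_succ_r'. apply f_equal. same. }
  eapply exec_seq; [apply H1|]. clear H1.
  eapply exec_seq; [apply (exec_push_word v [])|]. rewrite app_nil_r.
  set (N := 2 * 3 ^ n). clearbody N.
  assert (H2 : forall N M w, exec (Loop 3 (Inc 4 ;; push_word (repeat Xi k)))%com
    (st [0; wcode w; 0; N; M]) (st [0; wcode (repeat Xi (k * N) ++ w); 0; 0; N + M])).
  { clear. induction N as [|N IH]; intros M w.
    - rewrite Nat.mul_0_r. now apply exec_loop0.
    - eapply exec_loopS_st; [reflexivity| |].
      + cbn [setn]. xinc. apply exec_push_word.
      + eapply exec_to; [apply IH|].
        rewrite app_assoc, <- repeat_app. replace (k * N + k) with (k * S N) by lia.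
        apply f_equal. same. }
  eapply exec_seq; [apply H2|]. clear H2. rewrite Nat.add_0_r.
  eapply exec_seq; [apply exec_push_word|].
  assert (H3 : forall N w, exec (Loop 4 (push_word (repeat X k)))%com
    (st [0; wcode w; 0; 0; N]) (st [0; wcode (repeat X (k * N) ++ w); 0; 0; 0])).
  { clear. induction N as [|N IH]; intros w.
    - rewrite Nat.mul_0_r. now apply exec_loop0.
    - eapply exec_loopS_st; [reflexivity|cbn [setn]; apply exec_push_word|].
      eapply exec_to; [apply IH|].
      rewrite app_assoc, <- repeat_app. now replace (k * N + k) with (k * S N) by lia. }
  eapply exec_seq; [apply H3|]. done_mv.
Qed.

Lemma avoids_push_word w : avoids 5 (push_word w).
Proof.
  induction w as [|a w IH]; simpl; [exact I|].
  split; [exact IH|]. destruct a; simpl; intuition discriminate.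
Qed.

Lemma avoids_encode k u v : avoids 5 (encode k u v).
Proof.
  assert (Hi : forall i, i < 5 -> i <> 5) by lia.
  unfold encode. simpl. repeat split; auto using avoids_push_word; apply Hi; lia.
Qed.

(** * The diagonal machine *)

(** Capping jump targets at [len] makes all exits of the moved program lead to one address, its
    end. *)
Definition relocate (base len : nat) (c : instr) : instr :=
  match c with
  | INC r => INC r
  | DECJZ r j => DECJZ r (base + Nat.min j len)
  end.

Lemma crun_relocate q base p : placed q base (map (relocate base (length p)) p) ->
  forall pc f g, crun p pc f g ->
  csteps q (base + Nat.min pc (length p)) f (base + length p) g.
Proof.
  intros Hq pc f g. induction 1 as [pc f H|pc f pc' f' g H _ IH]; unfold cstep in H;
    destruct (nth_error p pc) as [c|] eqn:E.
  - destruct c as [r|r j]; [discriminate|]. destruct (f r); discriminate.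
  - apply nth_error_None in E. rewrite Nat.min_r by assumption. constructor.
  - assert (Hpc : pc < length p) by (apply nth_error_Some; congruence).
    assert (K := Hq pc (relocate base (length p) c)). rewrite nth_error_map, E in K.
    specialize (K eq_refl). rewrite (Nat.min_l pc) by lia.
    eapply csteps_step; [|exact IH]. unfold cstep. rewrite K.
    destruct c as [r|r j]; simpl.
    + injection H as <- <-. repeat f_equal. lia.
    + destruct (f r); injection H as <- <-; repeat f_equal; lia.
  - discriminate.
Qed.

(** On answer 0 the first added instruction jumps past the end. On answer 1 it decrements, and the
    second one jumps to itself forever, register 1 being 0. *)
Definition diagonal (c : com) (p : program) : program :=
  let b := clen c + length p in
  compile 5 0 c ++ map (relocate (clen c) (length p)) p ++ [DECJZ 1 (b + 2); DECJZ 1 (b + 1)].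

Lemma diagonal_halts c p n m g : avoids 5 c -> exec c (init n) (init m) ->
  crun p 0 (init m) g ->
  (g 1 = 0 -> exists h, crun (diagonal c p) 0 (init n) h) /\
  (g 1 = 1 -> ~ exists h, crun (diagonal c p) 0 (init n) h).
Proof.
  intros Hc Hn Hp. set (q := diagonal c p). set (b := clen c + length p).
  assert (Hq : placed q 0 q) by (intros k i H; exact H).
  unfold q at 2, diagonal in Hq. fold b in Hq.
  apply placed_app in Hq. destruct Hq as [H1 Hq]. rewrite length_compile in Hq.
  apply placed_app in Hq. destruct Hq as [H2 H3].
  rewrite length_map in H3. simpl in H2, H3. fold b in H3.
  assert (S1 := compile_correct q 5 c _ _ Hn Hc eq_refl 0 H1). simpl in S1.
  assert (S2 := crun_relocate q _ p H2 _ _ _ Hp). rewrite Nat.add_0_r in S2.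
  assert (S3 := csteps_trans _ _ _ _ _ _ _ S1 S2). fold b in S3. clear S1 S2.
  apply placed_cons in H3. destruct H3 as [H3 H4].
  apply placed_cons in H4. destruct H4 as [H4 _].
  split; intros Hg.
  - exists g. rewrite (csteps_crun _ _ _ _ _ S3).
    eapply crun_step; [unfold cstep; now rewrite H3, Hg|].
    apply crun_stop. unfold cstep.
    replace (nth_error q (b + 2)) with (@None instr); [reflexivity|].
    symmetry. apply nth_error_None. unfold q, diagonal.
    rewrite !length_app, length_compile, length_map. simpl. fold b. lia.
  - intros (h & Hh). rewrite (csteps_crun _ _ _ _ _ S3) in Hh.
    inversion Hh as [? ? K|? ? pc' f' ? K Hh']; subst; unfold cstep in K;
      rewrite H3, Hg in K; [discriminate|]. injection K as <- <-.
    revert Hh'.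
    apply (crun_diverges q (S b) (fun f => f 1 = 0)); [|apply upd_eq].
    intros f Hf. exists (S b), f, f. split; [|split; [constructor|exact Hf]].
    unfold cstep. now rewrite H4, Hf, Nat.add_1_r.
Qed.

(** An equality of words, not only of group elements, because the decider is run on the code of a
    word; the right side has the shape that [encode] produces. *)
Lemma toks_start m N : toks m (start N) =
  repeat X (m * N) ++ kap (cA 0) ++ repeat Xi (m * N) ++ toks m [at0 cV; at0 cV'].
Proof.
  change (start N) with ([(cA 0, (Z.of_nat N, 0%Z))] ++ [at0 cV; at0 cV']).
  rewrite toks_app. cbn [toks flat_map tokw]. unfold conj.
  change (pow Y 0) with (@nil letter).
  rewrite !app_nil_r, <- Nat2Z.inj_mul, pow_nat, <- !app_assoc.
  unfold winv. now rewrite map_repeat, rev_repeat.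
Qed.

Theorem theorem2 :
  exists gens : list word, ~ cm_decidable (in_submonoid gens).
Proof.
  destruct universal_program as (p & Hp).
  set (F := fractions 0 p).
  assert (HF : positive F) by apply fractions_positive.
  exists (gens_of (colors F) (rules_of F)). intros (q & Hq).
  (* There is no circularity: [c] builds the word from its input, so the machine is fixed before its
     own code n is taken as that input. *)
  set (c := encode (colors F) (kap (cA 0)) (toks (colors F) [at0 cV; at0 cV'])).
  set (G := fractions 0 (diagonal c q)).
  set (n := code G). set (N := 2 * 3 ^ n).
  (* The chain of equivalences: membership, halting of [F] from N, of [p] on n, of [G] from N, and
     of the diagonal machine on n. *)
  assert (Hiff : in_submonoid (gens_of (colors F) (rules_of F)) (toks (colors F) (start N)) <->
    exists g, crun (diagonal c q) 0 (init n) g).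
  { rewrite (fractions_correct (diagonal c q) n).
    fold G. unfold n. rewrite <- (Hp G (fractions_positive _ _)).
    rewrite (fractions_correct p (code G)).
    split; [apply member_fhalt, HF|apply fhalt_member, HF]. }
  destruct (Hq (toks (colors F) (start N))) as (fuel & g & Hrun & Hg).
  assert (Hc := exec_encode (colors F) (kap (cA 0)) (toks (colors F) [at0 cV; at0 cV']) n).
  fold N in Hc. rewrite <- toks_start in Hc.
  destruct (diagonal_halts c q n _ g (avoids_encode _ _ _) Hc (run_crun _ _ _ _ _ Hrun))
    as [H0 H1].
  tauto.
Qed.
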